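(* Let $C_0\ge1$. There is a constant $C$ depending only on $C_0$ such that the following holds. Let $\delta_1,\delta_2,\mu>0$, let $a$ be a smooth function with $\mathrm{supp}(a)\subset I\times J$ where $I,J\subset\mathbb R$ are intervals with $|I|\le\delta_1$, $|J|\le\delta_2$, and $$|a|\le C_0,\qquad |\partial_y a|\le C_0\delta_2^{-1},\qquad |\partial_y^2a|\le C_0\delta_2^{-2}.$$ Let $S$ be a real-valued smooth function such that, with $P=\partial_x\partial_y(\partial_x-\partial_y)S$, for all $(x,y)\in\mathrm{Conv}(\mathrm{supp}(a))$: $$|P(x,y)|\ge C_0^{-1}\mu,\qquad |\partial_y^\beta P(x,y)|\le C_0\,\mu\,\delta_2^{-\beta}\quad(\beta=1,2).$$ Then for all $\lambda\in\mathbb R\setminus\{0\}$ and $f_1,f_2,f_3\in L^2(\mathbb R)$, $$\Big|\iint e^{i\lambda S(x,y)}f_1(x)f_2(y)f_3(x+y)a(x,y)\,dx\,dy\Big|\le C|\lambda\mu|^{-1/6}\prod_{j=1}^3\|f_j\|_2.$$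
   Context: $\mathrm{Conv}(X)$ is the convex hull of $X\subset\mathbb R^2$. Note $P$ is a constant multiple of $D_{\boldsymbol\pi_0^\perp}S$ for the projections $\boldsymbol\pi_0(x,y)=(x,y,x+y)$. *)

(* Defs.v *)
From HB Require Import structures.
From mathcomp Require Import all_boot all_order all_algebra.
From mathcomp Require Import all_classical all_reals all_analysis.
From mathcomp Require Import complex.
Set Implicit Arguments. Unset Strict Implicit. Unset Printing Implicit Defensive.
Import Order.TTheory GRing.Theory Num.Theory.
Import numFieldNormedType.Exports.
Local Open Scope classical_set_scope.
Local Open Scope ring_scope.

Section Defs.
Variable R : realType.

Definition leb := (@lebesgue_measure R).
Definition leb2 := (leb \x leb)%E.

Definition pdx (f : R * R -> R) : R * R -> R :=
  fun p => derive1 (fun t => f (t, p.2)) p.1.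
Definition pdy (f : R * R -> R) : R * R -> R :=
  fun p => derive1 (fun t => f (p.1, t)) p.2.

Fixpoint pd_word (w : seq bool) (f : R * R -> R) : R * R -> R :=
  match w with
  | [::] => f
  | b :: w' => (if b then pdx else pdy) (pd_word w' f)
  end.

Definition smooth2 (f : R * R -> R) : Prop :=
  forall w : seq bool,
    continuous (pd_word w f) /\
    (forall p : R * R,
       derivable (fun t => pd_word w f (t, p.2)) p.1 1 /\
       derivable (fun t => pd_word w f (p.1, t)) p.2 1).

Definition csmooth2 (a : R * R -> R[i]) : Prop :=
  smooth2 (fun p => complex.Re (a p)) /\ smooth2 (fun p => complex.Im (a p)).
Definition cpdy (a : R * R -> R[i]) : R * R -> R[i] :=
  fun p => Complex (pdy (fun q => complex.Re (a q)) p)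
                   (pdy (fun q => complex.Im (a q)) p).

Definition cabs (z : R[i]) : R := Normc.normc z.

Definition supp (a : R * R -> R[i]) : set (R * R) := closure [set p | a p != 0].

Definition convex2 (K : set (R * R)) : Prop :=
  forall u v : R * R, K u -> K v -> forall t : R, 0 <= t <= 1 ->
    K ((1 - t) * u.1 + t * v.1, (1 - t) * u.2 + t * v.2).
Definition Conv (X : set (R * R)) : set (R * R) :=
  [set p | forall K, convex2 K -> X `<=` K -> K p].

Definition expi (t : R) : R[i] := Complex (cos t) (sin t).

Definition cintegral2 (F : R * R -> R[i]) : R[i] :=
  Complex (Rintegral leb2 setT (fun p => complex.Re (F p)))
          (Rintegral leb2 setT (fun p => complex.Im (F p))).

Definition L2 (f : R -> R[i]) : Prop :=
  measurable_fun setT (fun x => complex.Re (f x)) /\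
  measurable_fun setT (fun x => complex.Im (f x)) /\
  (\int[leb]_x ((cabs (f x)) ^+ 2)%:E < +oo)%E.
Definition L2norm (f : R -> R[i]) : R :=
  Num.sqrt (fine (\int[leb]_x ((cabs (f x)) ^+ 2)%:E)%E).

End Defs.

(* Main.v *)
Require Import Defs.
From HB Require Import structures.
From mathcomp Require Import all_boot all_order all_algebra.
From mathcomp Require Import all_classical all_reals all_analysis.
From mathcomp Require Import measurable_realfun complex.
From mathcomp Require Import ring lra.
Import Order.TTheory GRing.Theory Num.Theory.
Import numFieldNormedType.Exports.
Local Open Scope classical_set_scope.
Local Open Scope ring_scope.
Set Implicit Arguments. Unset Strict Implicit. Unset Printing Implicit Defensive.

(** Write z = x + y and apply TT* with respect to f_3: the square of the form is at
    most ||f_3||^2 times the integral over t of J(t), the integral over (x, y) of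
    H(x, y) times the conjugate of H(x - t, y + t), with H = e^(i lam S) f_1 f_2 a.
    Trivially |J(t)| <= C_0^2 ||f_1||^2 ||f_2||^2.  On the other hand J(t) is a
    bilinear form in F(x) = f_1(x) conj f_1(x - t) and G(y) = f_2(y) conj f_2(y + t)
    with phase U(x, y) = S(x, y) - S(x - t, y + t), whose mixed derivative is t times
    a value of P.  A second TT*, together with two integrations by parts in y, gives
    |J(t)| <= C |lam mu t|^(-1/2) ||F||_2 ||G||_2.  The trivial bound is used for
    |t| <= |lam mu|^(-1/3) and the other one elsewhere; since the integral over t of
    ||F||^2 is ||f_1||^4, and similarly for G, the integral of |J| is at most
    C |lam mu|^(-1/3) ||f_1||^2 ||f_2||^2.

    Only real parts of the form are estimated (its imaginary part is the real part of
    the form at - i f_1), first for bounded f_j with bounded support, and then in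
    general by truncation and dominated convergence. *)

(** * Bounded functions supported in sets of finite measure *)

(** Two integrations by parts are made because the kernel of the second TT* must be integrable in
    the shift s = x' - x: one of them would give only 1/|s|, while d2 / (1 + (k s)^2) with k = d2
    |lam t| m / C0 has integral pi d2 / k. There d2 cancels and the size of the supports does not
    enter, which is why the final constant depends on C_0 alone.

    They take place on an interval of y on which the amplitude may vanish, yet the derivative of the
    phase must stay large on all of it. The values of P that occur there are taken at convex
    combinations of points of supp(a); hence the hypotheses on Conv(supp(a)).

    With r = |lam mu|^(-1/6), the range |t| <= r^2 has length 2 r^2, and for |t| > r^2 the factor
    |lam mu t|^(-1/2) is at most r^2: the two contributions balance, and r is the square root of
    their common size.

    Cauchy-Schwarz and geometric means enter as 2 u v <= s u^2 + v^2 / s with s free, chosen only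
    after integration, so that no square root of a function is ever integrated. *)

Section OpenProd.
Variable R : realType.

(** The product sigma-algebra is generated by rectangles, so U is written as the countable union of
    the squares with rational centre and half-side 1/(n+1) that it contains. *)
Lemma open_measurable2 (U : set (R * R)) : open U ->
  @measurable _ (measurableTypeR R * measurableTypeR R)%type U.
Proof.
move=> oU.
pose B (q : rat * rat * nat) : set (R * R) :=
  [set p | `|ratr q.1.1 - p.1| < q.2.+1%:R^-1 /\ `|ratr q.1.2 - p.2| < q.2.+1%:R^-1].
have -> : U = \bigcup_(q in [set: rat * rat * nat])
    (if `[< B q `<=` U >] then B q else set0).
  apply/seteqP; split=> [p Up|p [q _]]; last first.
    by case: ifPn => // /asboolP; exact.
  have /nbhs_ballP[e /= e0 eU] : nbhs p U by exact: open_nbhs_nbhs.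
  have [n ne] : exists n : nat, n.+1%:R^-1 < e / 2.
    have e20 : 0 < e / 2 by rewrite divr_gt0.
    have [n _ /(_ n (leqnn n))] := near_infty_natSinv_lt (PosNum e20).
    by exists n.
  have [r [rE r0]] : exists r : R, r = n.+1%:R^-1 /\ 0 < r.
    by exists n.+1%:R^-1; rewrite invr_gt0.
  rewrite -rE in ne.
  have rq (x : R) : exists q : rat, `|ratr q - x| < r.
    have /rat_in_itvoo[q] : x - r < x + r by lra.
    rewrite in_itv/= => /andP[q1 q2]; exists q.
    by rewrite ltr_norml; apply/andP; split; lra.
  have [q1 hq1] := rq p.1; have [q2 hq2] := rq p.2.
  exists (q1, q2, n) => //.
  rewrite asboolT//= => [|y]; rewrite /B/= -rE// => -[/= y1 y2]; apply: eU; split => /=.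
    rewrite /ball/=; apply: le_lt_trans (ler_distD (ratr q1) _ _) _.
    by rewrite (distrC p.1); lra.
  rewrite /ball/=; apply: le_lt_trans (ler_distD (ratr q2) _ _) _.
  by rewrite (distrC p.2); lra.
apply: countable_bigcupT_measurable => // q; case: ifPn => // _.
rewrite (_ : B q = (ball (ratr q.1.1 : R) q.2.+1%:R^-1 : set R) `*` (ball (ratr q.1.2 : R) q.2.+1%:R^-1 : set R))//.
by apply: measurableX; exact: measurable_ball.
Qed.

Lemma continuous_measurable2 (f : R * R -> R) : continuous f ->
  @measurable_fun _ _ (measurableTypeR R * measurableTypeR R)%type R setT f.
Proof.
move=> cf; apply: (measurability _ (RGenOInfty.measurableE R)) => //.
move=> _ [_ [x ->] <-]; rewrite setTI; apply: open_measurable2.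
by apply: (open_comp (fun p _ => cf p)); exact: interval_open.
Qed.

End OpenProd.

Section Nice.
Variable R : realType.

(** This class is kept by sums, products, translations and partial integration, so the integrability
    needed for linearity and Fubini comes for free until the truncation is removed. *)
Definition nice {d} {T : measurableType d} (mu : {measure set T -> \bar R})
    (f : T -> R) :=
  measurable_fun setT f /\ exists M D, [/\ measurable D, (mu D < +oo)%E,
    forall x, `|f x| <= M & forall x, ~ D x -> f x = 0].

Lemma nice_integrable {d} {T : measurableType d}
    (mu : {measure set T -> \bar R}) f :
  nice mu f -> mu.-integrable setT (EFin \o f).
Proof.
move=> [mf [M [D [mD Doo fM fD]]]].
apply: (@le_integrable _ _ _ mu _ measurableT _ (EFin \o (fun x => M * \1_D x))) => //.
- exact/measurable_EFinP.
- move=> x _ /=; rewrite lee_fin indicE; case: (pselect (D x)) => Dx.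
    by rewrite mem_set// mulr1; apply: le_trans (fM x) (ler_norm _).
  by rewrite (fD _ Dx) normr0.
- rewrite (_ : _ \o _ = (fun x => M%:E * (\1_D x)%:E)%E); last by apply/funext => x; rewrite /= EFinM.
  apply: integrableZl => //.
  apply/integrableP; split; first by exact/measurable_EFinP.
  by under eq_integral do rewrite gee0_abs//; rewrite integral_indic// setIT.
Qed.

(** The support lies in a rectangle with sides of finite measure, not merely in a set of finite
    product measure, so that every slice is [nice] and not only almost every one. *)
Definition nice2 {d1 d2} {T1 : measurableType d1} {T2 : measurableType d2}
    (m1 : {measure set T1 -> \bar R}) (m2 : {measure set T2 -> \bar R})
    (f : T1 * T2 -> R) :=
  measurable_fun setT f /\ exists M D1 D2,
    [/\ measurable D1, (m1 D1 < +oo)%E, measurable D2, (m2 D2 < +oo)%E &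
       (forall p, `|f p| <= M) /\ forall x y, ~ (D1 x /\ D2 y) -> f (x, y) = 0].

Section Nice2.
Context {d1 d2} {T1 : measurableType d1} {T2 : measurableType d2}.
Variables (m1 : {sigma_finite_measure set T1 -> \bar R})
  (m2 : {sigma_finite_measure set T2 -> \bar R}).
Variable f : T1 * T2 -> R.
Hypothesis nf : nice2 m1 m2 f.

Lemma nice2_nice : nice (m1 \x m2)%E f.
Proof.
case: nf => mf [M [D1 [D2 [mD1 D1oo mD2 D2oo [fM f0]]]]].
split=> //; exists M, (D1 `*` D2); split => //.
- exact: measurableX.
- by rewrite /= product_measure1E// lte_mul_pinfty// ge0_fin_numE.
- by move=> [x y] nD; exact: f0.
Qed.

Lemma nice2_secx x : nice m2 (fun y => f (x, y)).
Proof.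
case: nf => mf [M [D1 [D2 [mD1 D1oo mD2 D2oo [fM f0]]]]].
split; first exact: measurable_fun_pair2.
by exists M, D2; split => // y nD; apply: f0 => -[].
Qed.

Lemma nice2_secy y : nice m1 (fun x => f (x, y)).
Proof.
case: nf => mf [M [D1 [D2 [mD1 D1oo mD2 D2oo [fM f0]]]]].
split; first exact: measurable_fun_pair1.
by exists M, D1; split => // x nD; apply: f0 => -[].
Qed.

Lemma nice2_Rfubini1 :
  \int[(m1 \x m2)%E]_p f p = \int[m1]_x \int[m2]_y f (x, y).
Proof.
rewrite /Rintegral -(integral12_prod_meas1 (nice_integrable nice2_nice)).
congr fine; apply: eq_integral => x _.
rewrite fineK//; apply: integrable_fin_num => //.
exact: nice_integrable (nice2_secx x).
Qed.

Lemma nice2_Rfubini2 :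
  \int[(m1 \x m2)%E]_p f p = \int[m2]_y \int[m1]_x f (x, y).
Proof.
rewrite /Rintegral -(integral21_prod_meas1 (nice_integrable nice2_nice)).
congr fine; apply: eq_integral => y _.
rewrite fineK//; apply: integrable_fin_num => //.
exact: nice_integrable (nice2_secy y).
Qed.

Lemma nice2_F : nice m1 (fun x => \int[m2]_y f (x, y)).
Proof.
case: (nf) => mf [M [D1 [D2 [mD1 D1oo mD2 D2oo [fM f0]]]]].
split.
  apply: (measurableT_comp (fine_measurable _)) => //=.
  exact: (measurable_fubini_F (nice_integrable nice2_nice)).
exists (M * fine (m2 D2)), D1; split => // x.
  apply: le_trans (le_normr_Rintegral _ (nice_integrable (nice2_secx x))) _ => //.
  rewrite -Rintegral_cst// [leRHS]Rintegral_mkcond.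
  have nc : nice m2 ((fun=> M) \_ D2).
    split; first by apply/(measurable_restrictT _ _).1 => //.
    exists `|M|, D2; split => // y; rewrite patchE.
      by case: ifPn => //; rewrite normr0.
    by move=> nD; rewrite memNset.
  apply: le_Rintegral => //.
  - apply: nice_integrable; have [mfx [M' [D [? ? ? h]]]] := nice2_secx x.
    split; first exact: measurableT_comp.
    by exists M', D; split => // y; rewrite ?normr_id// => /h ->; rewrite normr0.
  - exact: nice_integrable.
  - move=> y _; rewrite patchE; case: ifPn => // yD.
    by rewrite f0 ?normr0// => -[_ yD2]; move: yD; rewrite mem_set.
move=> nx; transitivity (\int[m2]_y (0 : R)).
  by apply: eq_Rintegral => y _; rewrite f0// => -[].
by rewrite Rintegral_cst// mul0r.
Qed.

End Nice2.
End Nice.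

(** * Translations *)

Section Translation.
Variable R : realType.
Notation mu := (@lebesgue_measure R).

Lemma measurable_addr_const (c : R) :
  @measurable_fun _ _ (measurableTypeR R) (measurableTypeR R) setT (fun x => x + c).
Proof. exact: (@measurable_funD _ _ _ _ id (cst c)). Qed.

(** Both measures agree on half-open intervals, which determine Lebesgue measure. *)
Lemma lebesgue_translation (c : R) (A : set (measurableTypeR R)) : measurable A ->
  pushforward mu (fun x : measurableTypeR R => (x + c : measurableTypeR R)) A = mu A.
Proof.
move=> mA; have mc := measurable_addr_const c.
pose mf := isMeasurableFun.Build _ _ _ _ _ mc.
pose F : {mfun measurableTypeR R >-> measurableTypeR R} :=
  MeasurableFun.Pack (MeasurableFun.Class mf).
apply/esym.
apply: (@lebesgue_measure_unique _ (pushforward mu F)) => // _ [[a b] _ <-].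
change (mu `]a, b]%classic = mu ((fun x : R => x + c) @^-1` `]a, b]%classic)).
rewrite [X in _ = _ X](_ : _ = `](a - c), (b - c)]%classic); last first.
  by apply/seteqP; split => x /=; rewrite !in_itv/= ltrBlDr lerBrDr.
rewrite /= !lebesgue_measure_itv/= !lte_fin ltrD2r; case: ifPn => // _.
by rewrite -!EFinB; congr EFin; lra.
Qed.

Lemma nice_shift (f : R -> R) c : nice mu f -> nice mu (fun x => f (x + c)).
Proof.
move=> [mf [M [D [mD Doo fM f0]]]]; have mc := measurable_addr_const c.
split; first exact: (measurableT_comp mf mc).
exists M, ((fun x => x + c) @^-1` D); split => //.
- by rewrite -[X in measurable X]setTI; exact: mc.
- by rewrite [X in (X < _)%E](lebesgue_translation c mD).
- by move=> x; exact: f0.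
Qed.

Lemma Rintegral_shift (f : R -> R) c : measurable_fun setT f ->
   mu.-integrable setT (EFin \o (fun x => f (x + c))) ->
  \int[mu]_x f (x + c) = \int[mu]_x f x.
Proof.
move=> mf intf; have mc := measurable_addr_const c.
rewrite /Rintegral; congr fine; symmetry.
pose F : {mfun measurableTypeR R >-> measurableTypeR R} :=
  MeasurableFun.Pack (MeasurableFun.Class (isMeasurableFun.Build _ _ _ _ _ mc)).
rewrite (eq_measure_integral (pushforward mu F)); last first.
  by move=> A mA _; rewrite [RHS](lebesgue_translation c mA).
rewrite integral_pushforward//.
exact/measurable_EFinP.
Qed.

Lemma nice_Rintegral_shift (f : R -> R) c : nice mu f ->
  \int[mu]_x f (x + c) = \int[mu]_x f x.
Proof.
move=> nf; apply: Rintegral_shift; first by case: nf.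
exact/nice_integrable/nice_shift.
Qed.

End Translation.

(** * Bounded supports, swaps and shears in the plane *)

Section Box.
Variable R : realType.
Notation mu := (@lebesgue_measure R).
Notation mu2 := (mu \x mu)%E.
Notation T1 := (measurableTypeR R).
Notation T2 := (T1 * T1)%type.

Lemma itv_lebesgue_lty (a b : R) : (mu (`[a, b]%classic : set R) < +oo)%E.
Proof. by rewrite lebesgue_measure_itv/=; case: ifP => // _; rewrite -EFinB ltry. Qed.

Lemma box_nice (f : R -> R) M N : measurable_fun setT f -> (forall x, `|f x| <= M) ->
  (forall x, f x != 0 -> `|x| <= N) -> nice mu f.
Proof.
move=> mf fM f0; split=> //; exists M, `[-N, N]%classic; split => //.
- exact: itv_lebesgue_lty.
- move=> x nx; apply/eqP; apply: contra_notT nx => /f0.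
  by rewrite /= in_itv/= ler_norml.
Qed.

Lemma box_nice2 (f : T2 -> R) M N : measurable_fun setT f -> (forall x, `|f x| <= M) ->
  (forall x y, f (x, y) != 0 -> `|x| <= N /\ `|y| <= N) -> nice2 mu mu f.
Proof.
move=> mf fM f0; split=> //; exists M, `[-N, N]%classic, `[-N, N]%classic; split => //.
- exact: itv_lebesgue_lty.
- exact: itv_lebesgue_lty.
split=> // x y nx; apply/eqP; apply: contra_notT nx => /f0.
by rewrite /= !in_itv/= !ler_norml.
Qed.

Lemma lebesgue2_sigma_finite : sigma_finite [set: T2] mu2.
Proof.
exists (fun n => `[- n%:R, n%:R]%classic `*` `[- n%:R, n%:R]%classic).
  apply/esym/seteqP; split => // -[x y] _.
  have /archi_boundP hx : 0 <= Num.max `|x| `|y| by rewrite le_max normr_ge0.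
  exists (Num.bound (Num.max `|x| `|y|)) => //=.
  by rewrite !in_itv/= -!ler_norml; move/ltW: hx; rewrite ge_max => /andP.
move=> n; split; first exact: measurableX.
rewrite product_measure1E// lte_mul_pinfty//.
  by rewrite ge0_fin_numE// itv_lebesgue_lty.
exact: itv_lebesgue_lty.
Qed.

(* HB does not infer this structure on products of sigma-finite measures. *)
Definition lebesgue2 : {sigma_finite_measure set T2 -> \bar R} :=
  HB.pack mu2 (Measure_isSigmaFinite.Build _ _ _ mu2 lebesgue2_sigma_finite).

Lemma box_nice3 (f : T2 * T1 -> R) M N : measurable_fun setT f -> (forall x, `|f x| <= M) ->
  (forall x y z, f ((x, y), z) != 0 -> [/\ `|x| <= N, `|y| <= N & `|z| <= N]) ->
  nice2 mu2 mu f.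
Proof.
move=> mf fM f0; split=> //.
exists M, (`[-N, N]%classic `*` `[-N, N]%classic), `[-N, N]%classic; split => //.
- exact: measurableX.
- rewrite /= product_measure1E// lte_mul_pinfty//.
  by rewrite ge0_fin_numE// itv_lebesgue_lty.
  exact: itv_lebesgue_lty.
- exact: itv_lebesgue_lty.
split=> // -[x y] z nx; apply/eqP; apply: contra_notT nx => /f0.
by rewrite /= !in_itv/= !ler_norml => -[-> -> ->].
Qed.

Lemma measurable_fun_swap : @measurable_fun _ _ T2 T2 setT (fun p => (p.2, p.1)).
Proof. by apply/measurable_fun_pairP; split; [exact: measurable_snd|exact: measurable_fst]. Qed.

Lemma nice2_swap (f : T2 -> R) : nice2 mu mu f -> nice2 mu mu (fun p => f (p.2, p.1)).
Proof.
move=> [mf [M [D1 [D2 [? ? ? ? [fM f0]]]]]]; split.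
  exact: (measurableT_comp mf measurable_fun_swap).
exists M, D2, D1; split => //; split => [p|x y h]; first exact: fM.
by apply: f0 => -[? ?]; apply: h.
Qed.

Lemma Rintegral_swap (f : T2 -> R) : nice2 mu mu f ->
  \int[mu2]_p f (p.2, p.1) = \int[mu2]_p f p.
Proof.
by move=> nf; rewrite (nice2_Rfubini1 (nice2_swap nf)) (nice2_Rfubini2 nf).
Qed.

Lemma measurable_fun_shear (s t : R) :
  @measurable_fun _ _ T2 T2 setT (fun p => (p.1 + s * p.2, p.2 + t)).
Proof.
apply/measurable_fun_pairP; split => /=.
  apply: (@measurable_funD _ _ _ _ fst (fun p => s * p.2)); first exact: measurable_fst.
  exact: (@measurable_funM _ _ _ _ (cst s) snd).
exact: (@measurable_funD _ _ _ _ snd (cst t)).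
Qed.

(** For a fixed second coordinate the shear is a translation of the first, so Fubini reduces it to
    translation invariance on the line. *)
Lemma Rintegral_shear (f : T2 -> R) (s : R) : nice2 mu mu f ->
  nice2 mu mu (fun p : T2 => f (p.1 + s * p.2, p.2)) ->
  \int[mu2]_p f (p.1 + s * p.2, p.2) = \int[mu2]_p f p.
Proof.
move=> nf nsf; rewrite (nice2_Rfubini2 nf) (nice2_Rfubini2 nsf)/=.
apply: eq_Rintegral => y _.
exact: (nice_Rintegral_shift (s * y) (nice2_secy nf y)).
Qed.

End Box.

Section Reals.
Variable R : realType.

(* the discriminant argument: optimise over t in 2 L <= t A + B / t *)
Lemma discriminant_le (L A B : R) : 0 <= A -> 0 <= B ->
  (forall t, 0 < t -> 2 * L <= t * A + B / t) -> 0 <= L -> L ^+ 2 <= A * B.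
Proof.
move=> A0 B0 h L0.
have [A00|Apos] := eqVneq A 0.
  suff -> : L = 0 by rewrite expr2 !mul0r A00 mul0r.
  apply/eqP; rewrite eq_le L0 andbT leNgt; apply/negP => Lpos.
  (* When A = 0, this t makes B / t smaller than L, against 2 L <= B / t. *)
  have tp : 0 < (B + 1) / L by rewrite divr_gt0//; lra.
  have := h _ tp; rewrite A00 mulr0 add0r invf_div.
  have -> : B * (L / (B + 1)) = L - L / (B + 1).
    have B1 : B + 1 != 0 by rewrite gt_eqF//; lra.
    by field.
  have : 0 < L / (B + 1) by rewrite divr_gt0//; lra.
  lra.
have Ap : 0 < A by rewrite lt_def Apos.
have [L00|Lne] := eqVneq L 0; first by rewrite L00 expr2 mulr0; exact: mulr_ge0.
have Lp : 0 < L by rewrite lt_def Lne.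
(* At t = L / A the first term equals L, so the second, A B / L, is at least L. *)
have tp : 0 < L / A by rewrite divr_gt0.
have e1 : L / A * A = L by field.
have e2 : B / (L / A) = B * A / L by field; rewrite Lne.
have := h _ tp; rewrite e1 e2 => H.
have : L <= B * A / L by lra.
by rewrite ler_pdivlMr// expr2 (mulrC A).
Qed.

End Reals.

(** * The TT* inequality *)

Section TTstar.
Variable R : realType.
Notation mu := (@lebesgue_measure R).
Notation mu2 := (mu \x mu)%E.
Notation T1 := (measurableTypeR R).
Notation T2 := (T1 * T1)%type.

Lemma normM_le (x y M : R) : `|x| <= M -> `|y| <= M -> `|x * y| <= M * M.
Proof. by move=> hx hy; rewrite normrM; apply: ler_pM. Qed.

Lemma normMD_le (x y z w M : R) : `|x| <= M -> `|y| <= M -> `|z| <= M -> `|w| <= M ->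
  `|x * y + z * w| <= 2 * (M * M).
Proof.
move=> hx hy hz hw; apply: le_trans (ler_normD _ _) _.
by have := normM_le hx hy; have := normM_le hz hw; lra.
Qed.

(** This is the three-variable integrand that appears on squaring a slice integral. The shift is a
    difference of two second coordinates in the support, whence 2 N. *)
Lemma sec_mul_nice2 (k : T2 -> R) M N :
  measurable_fun setT k -> (forall p, `|k p| <= M) ->
  (forall x y, k (x, y) != 0 -> `|x| <= N /\ `|y| <= N) ->
  nice2 mu2 mu (fun q : T2 * T1 => k q.1 * k (q.1.1, q.1.2 + q.2)).
Proof.
move=> mk kM k0; apply: (@box_nice3 _ _ (M * M) (N + N)) => [|q|x y z /=].
- apply: measurable_funM; first exact: (measurableT_comp mk measurable_fst).
  apply: (measurableT_comp mk); apply/measurable_fun_pairP; split => /=.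
    exact: (measurableT_comp measurable_fst measurable_fst).
  apply: (@measurable_funD _ _ _ _ (snd \o fst) snd).
    exact: (measurableT_comp measurable_snd measurable_fst).
  exact: measurable_snd.
- exact: normM_le.
- rewrite mulf_eq0 negb_or => /andP[/k0[hx hy] /k0[_ hyz]].
  split.
  + by apply: (le_trans hx); have := le_trans (normr_ge0 _) hx; lra.
  + by apply: (le_trans hy); have := le_trans (normr_ge0 _) hy; lra.
  + rewrite (_ : z = (y + z) - y); last by ring.
    by apply: le_trans (ler_normB _ _) _; lra.
Qed.

Lemma niceD {d} {T : measurableType d} (m : {measure set T -> \bar R}) (f g : T -> R) :
  nice m f -> nice m g -> nice m (fun x => f x + g x).
Proof.
move=> [mf [M [D [mD Doo fM f0]]]] [mg [M' [D' [mD' D'oo gM g0]]]].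
split; first exact: measurable_funD.
exists (M + M'), (D `|` D'); split.
- exact: measurableU.
- by apply: le_lt_trans (measureU2 _ _ _) _ => //; exact: lte_add_pinfty.
- by move=> x; apply: le_trans (ler_normD _ _) _; exact: lerD.
- by move=> x /not_orP[nD nD']; rewrite f0// g0// addr0.
Qed.

Lemma niceMr {d} {T : measurableType d} (m : {measure set T -> \bar R}) (f g : T -> R) K :
  nice m f -> measurable_fun setT g -> (forall x, `|g x| <= K) ->
  nice m (fun x => f x * g x).
Proof.
move=> [mf [M [D [mD Doo fM f0]]]] mg gK.
split; first exact: measurable_funM.
exists (M * K), D; split => // x; first by rewrite normrM ler_pM.
by move=> nD; rewrite f0// mul0r.
Qed.

Lemma nice_bounded {d} {T : measurableType d} (m : {measure set T -> \bar R}) (f : T -> R) :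
  nice m f -> exists M, forall x, `|f x| <= M.
Proof. by move=> [_ [M [D []]]]; exists M. Qed.

Lemma niceM {d} {T : measurableType d} (m : {measure set T -> \bar R}) (f g : T -> R) :
  nice m f -> nice m g -> nice m (fun x => f x * g x).
Proof.
by move=> nf ng; have [K gK] := nice_bounded ng; apply: niceMr nf _ gK; case: ng.
Qed.

Lemma niceZ {d} {T : measurableType d} (m : {measure set T -> \bar R}) (f : T -> R) c :
  nice m f -> nice m (fun x => c * f x).
Proof.
move=> nf; under eq_fun do rewrite mulrC.
by apply: (niceMr (g := cst c) (K := `|c|) nf) => //; exact: measurable_cst.
Qed.

Lemma nice_norm {d} {T : measurableType d} (m : {measure set T -> \bar R}) (f : T -> R) :
  nice m f -> nice m (fun x => `|f x|).
Proof.
move=> [mf [M [D [mD Doo fM f0]]]]; split; first exact: measurableT_comp.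
by exists M, D; split => // x; rewrite ?normr_id// => /f0->; rewrite normr0.
Qed.

Lemma nice_RintegralD {d} {T : measurableType d} (m : {measure set T -> \bar R}) (f g : T -> R) :
  nice m f -> nice m g -> \int[m]_x (f x + g x) = \int[m]_x f x + \int[m]_x g x.
Proof. by move=> nf ng; rewrite RintegralD//; exact: nice_integrable. Qed.

Lemma nice_RintegralZ {d} {T : measurableType d} (m : {measure set T -> \bar R}) (f : T -> R) c :
  nice m f -> \int[m]_x (c * f x) = c * \int[m]_x f x.
Proof. by move=> nf; rewrite RintegralZl//; exact: nice_integrable. Qed.

Lemma nice_le_Rintegral {d} {T : measurableType d} (m : {measure set T -> \bar R}) (f g : T -> R) :
  nice m f -> nice m g -> (forall x, f x <= g x) -> \int[m]_x f x <= \int[m]_x g x.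
Proof. by move=> nf ng fg; apply: le_Rintegral => //; exact: nice_integrable. Qed.

Lemma nice_le_normr {d} {T : measurableType d} (m : {measure set T -> \bar R}) (f : T -> R) :
  nice m f -> `|\int[m]_x f x| <= \int[m]_x `|f x|.
Proof. by move=> nf; apply: le_normr_Rintegral => //; exact: nice_integrable. Qed.

Section sq_slice.
Variables (k : T2 -> R) (M N : R).
Hypotheses (mk : measurable_fun setT k) (kM : forall p, `|k p| <= M)
  (k0 : forall x y, k (x, y) != 0 -> `|x| <= N /\ `|y| <= N).

Let nk : nice2 mu mu k := box_nice2 mk kM k0.

(** Write the square as a double integral over y and y', put y' = y + t, and exchange the order so
    that t is outermost. *)
Lemma sq_slice : \int[mu]_x (\int[mu]_y k (x, y)) ^+ 2 =
  \int[mu]_t \int[mu2]_p (k p * k (p.1, p.2 + t)).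
Proof.
have n3 := sec_mul_nice2 mk kM k0.
pose kk x := \int[mu]_y k (x, y).
have nkk : nice mu kk := nice2_F nk.
have [K kkK] := nice_bounded nkk.
have nkkk : nice2 mu mu (fun p : T2 => k p * kk p.1).
  apply: (@box_nice2 _ _ (M * K) N) => [|p|x y].
  - by apply: measurable_funM => //; apply: (measurableT_comp _ measurable_fst); case: nkk.
  - by rewrite normrM; apply: ler_pM.
  - by rewrite mulf_eq0 negb_or => /andP[/k0].
rewrite -(@nice2_Rfubini2 _ _ _ _ _ (lebesgue2 R) mu _ n3) (@nice2_Rfubini1 _ _ _ _ _ (lebesgue2 R) mu _ n3) /=.
transitivity (\int[mu2]_p (k p * kk p.1)).
  rewrite (nice2_Rfubini1 nkkk)/=; apply: eq_Rintegral => x _.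
  under [RHS]eq_Rintegral do rewrite mulrC.
  by rewrite (nice_RintegralZ _ (nice2_secx nk x)).
apply: eq_Rintegral => -[x y] _ /=.
have ns := nice_shift y (nice2_secx nk x).
under [RHS]eq_Rintegral do rewrite addrC.
by rewrite (nice_RintegralZ _ ns) (nice_Rintegral_shift y (nice2_secx nk x)).
Qed.

Lemma sq_slice_nice : nice mu (fun t => \int[mu2]_p (k p * k (p.1, p.2 + t))).
Proof.
have [mF [K [D1 [D2 [m1 o1 m2 o2 [F1 F2]]]]]] := sec_mul_nice2 mk kM k0.
apply: (@nice2_F _ _ _ _ _ mu (lebesgue2 R) (fun q => k q.2 * k (q.2.1, q.2.2 + q.1))).
split.
  apply: (measurableT_comp mF (_ : measurable_fun setT (fun q : T1 * T2 => (q.2, q.1)))).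
  by apply/measurable_fun_pairP; split; [exact: measurable_snd|exact: measurable_fst].
exists K, D2, D1; split => //; split => [q|x y h].
  exact: (F1 (q.2, q.1)).
by apply: (F2 y x) => -[? ?]; apply: h.
Qed.

End sq_slice.

(** With K(x) the integral of k(x, .), Fubini turns the form into the integral of Re(g K);
    Cauchy-Schwarz leaves the integral of |K|^2, which [sq_slice] identifies with that of J. *)
Lemma TTstar (gr gi : T1 -> R) (kr ki : T2 -> R) (M N : R) :
  measurable_fun setT gr -> measurable_fun setT gi ->
  measurable_fun setT kr -> measurable_fun setT ki ->
  (forall x, `|gr x| <= M) -> (forall x, `|gi x| <= M) ->
  (forall p, `|kr p| <= M) -> (forall p, `|ki p| <= M) ->
  (forall x, gr x != 0 -> `|x| <= N) -> (forall x, gi x != 0 -> `|x| <= N) ->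
  (forall x y, kr (x, y) != 0 -> `|x| <= N /\ `|y| <= N) ->
  (forall x y, ki (x, y) != 0 -> `|x| <= N /\ `|y| <= N) ->
  let J t := \int[mu2]_p (kr p * kr (p.1, p.2 + t) + ki p * ki (p.1, p.2 + t)) in
  nice mu J /\
  (\int[mu2]_p (gr p.1 * kr p - gi p.1 * ki p)) ^+ 2 <=
  (\int[mu]_x (gr x ^+ 2 + gi x ^+ 2)) * \int[mu]_t J t.
Proof.
move=> mgr mgi mkr mki grM giM krM kiM gr0 gi0 kr0 ki0 J.
pose Jr t := \int[mu2]_p (kr p * kr (p.1, p.2 + t)).
pose Ji t := \int[mu2]_p (ki p * ki (p.1, p.2 + t)).
have nJr : nice mu Jr := sq_slice_nice mkr krM kr0.
have nJi : nice mu Ji := sq_slice_nice mki kiM ki0.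
have JE : J = fun t => Jr t + Ji t.
  apply/funext => t; rewrite /J nice_RintegralD//.
    exact: (@nice2_secy _ _ _ _ _ (lebesgue2 R) mu _ (sec_mul_nice2 mkr krM kr0) t).
  exact: (@nice2_secy _ _ _ _ _ (lebesgue2 R) mu _ (sec_mul_nice2 mki kiM ki0) t).
split; first by rewrite JE; exact: niceD.
have ngr : nice mu gr := box_nice mgr grM gr0.
have ngi : nice mu gi := box_nice mgi giM gi0.
have nkr : nice2 mu mu kr := box_nice2 mkr krM kr0.
have nki : nice2 mu mu ki := box_nice2 mki kiM ki0.
pose Kr x := \int[mu]_y kr (x, y).
pose Ki x := \int[mu]_y ki (x, y).
have nKr : nice mu Kr := nice2_F nkr.
have nKi : nice mu Ki := nice2_F nki.
have -> : \int[mu]_t J t = \int[mu]_x (Kr x ^+ 2 + Ki x ^+ 2).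
  rewrite JE nice_RintegralD// nice_RintegralD; [|exact: niceM..].
  by congr (_ + _); symmetry; [exact: (sq_slice mkr krM kr0)|exact: (sq_slice mki kiM ki0)].
pose L := \int[mu2]_p (gr p.1 * kr p - gi p.1 * ki p).
have LE : L = \int[mu]_x (gr x * Kr x - gi x * Ki x).
  have nint : nice2 mu mu (fun p : T2 => gr p.1 * kr p - gi p.1 * ki p).
    apply: (@box_nice2 _ _ (2 * (M * M)) N) => [|p|x y].
    - by apply: measurable_funB; apply: measurable_funM => //; apply: (measurableT_comp _ measurable_fst).
    - by rewrite -mulrN; apply: normMD_le => //; rewrite normrN.
    - have [->|/kr0//] := eqVneq (kr (x, y)) 0.
      by rewrite mulr0 add0r oppr_eq0 mulf_eq0 negb_or => /andP[_ /ki0].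
  rewrite /L (nice2_Rfubini1 nint)/=; apply: eq_Rintegral => x _.
  rewrite RintegralB//.
  - by rewrite (nice_RintegralZ _ (nice2_secx nkr x)) (nice_RintegralZ _ (nice2_secx nki x)).
  - exact: nice_integrable (niceZ _ (nice2_secx nkr x)).
  - exact: nice_integrable (niceZ _ (nice2_secx nki x)).
have nA : nice mu (fun x => gr x ^+ 2 + gi x ^+ 2) by apply: niceD; exact: niceM.
have nB : nice mu (fun x => Kr x ^+ 2 + Ki x ^+ 2) by apply: niceD; exact: niceM.
have nC : nice mu (fun x => gr x * Kr x - gi x * Ki x).
  under eq_fun do rewrite -mulrN -mulN1r.
  by apply: niceD; apply: niceM => //; exact: niceZ.
rewrite -/L -(@real_normK _ L) ?num_real//.
apply: discriminant_le => //.
- by apply: Rintegral_ge0 => x _; rewrite addr_ge0// sqr_ge0.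
- by apply: Rintegral_ge0 => x _; rewrite addr_ge0// sqr_ge0.
move=> t t0; rewrite LE; apply: le_trans (_ : 2 * \int[mu]_x `|gr x * Kr x - gi x * Ki x| <= _).
  by rewrite ler_pM2l// nice_le_normr.
rewrite -!nice_RintegralZ//; last exact: nice_norm.
rewrite (mulrC _ t^-1) -!nice_RintegralZ// -nice_RintegralD//; [|exact: niceZ..].
apply: nice_le_Rintegral; [exact/niceZ/nice_norm|by apply: niceD; exact: niceZ|move=> x].
set a := gr x; set b := Kr x; set c := gi x; set d := Ki x.
(* Applied with both signs of each product, to bound the absolute value of the integrand
   pointwise. *)
have key (u v : R) : 2 * (u * v) <= t * u ^+ 2 + t^-1 * v ^+ 2.
  have : 0 <= t^-1 * (t * u - v) ^+ 2 by rewrite mulr_ge0 ?sqr_ge0// invr_ge0 ltW.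
  rewrite (_ : t^-1 * _ = t * u ^+ 2 + t^-1 * v ^+ 2 - 2 * (u * v)); first lra.
  by field; rewrite gt_eqF.
have h1 := key a b; have h2 := key (- c) d; have h3 := key (- a) b; have h4 := key c d.
rewrite !sqrrN in h1 h2 h3 h4.
have [_|_] := ger0P (a * b - c * d); lra.
Qed.

End TTstar.

(** * Smooth functions of two real variables *)

Section Smooth.
Variable R : realType.
Implicit Types (f g V : R * R -> R).

Lemma pd_word_cat (w1 w2 : seq bool) f :
  pd_word (w1 ++ w2) f = pd_word w1 (pd_word w2 f).
Proof. by elim: w1 => //= b w1 ->. Qed.

Lemma smooth2_pd (w : seq bool) f : smooth2 f -> smooth2 (pd_word w f).
Proof. by move=> sf w'; rewrite -pd_word_cat; exact: sf. Qed.

Lemma smooth2_pdx f : smooth2 f -> smooth2 (pdx f).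
Proof. exact: (@smooth2_pd [:: true]). Qed.

Lemma smooth2_pdy f : smooth2 f -> smooth2 (pdy f).
Proof. exact: (@smooth2_pd [:: false]). Qed.

Lemma smooth2_continuous f : smooth2 f -> continuous f.
Proof. by move=> /(_ [::])[]. Qed.

Lemma smooth2_is_derivex f (x y : R) : smooth2 f ->
  is_derive x 1 (fun t => f (t, y)) (pdx f (x, y)).
Proof.
move=> /(_ [::])[_ /(_ (x, y))[/= dx _]].
by apply: DeriveDef => //; rewrite /pdx derive1E.
Qed.

Lemma smooth2_is_derivey f (x y : R) : smooth2 f ->
  is_derive y 1 (fun t => f (x, t)) (pdy f (x, y)).
Proof.
move=> /(_ [::])[_ /(_ (x, y))[/= _ dy]].
by apply: DeriveDef => //; rewrite /pdy derive1E.
Qed.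

Lemma pdxB f g : smooth2 f -> smooth2 g ->
  pdx (fun p => f p - g p) = fun p => pdx f p - pdx g p.
Proof.
move=> sf sg; apply/funext => -[x y]; rewrite {1}/pdx/= derive1E.
have hf := smooth2_is_derivex x y sf; have hg := smooth2_is_derivex x y sg.
exact: (@derive_val _ _ _ _ _ _ _ (is_deriveB hf hg)).
Qed.

Lemma pdyB f g : smooth2 f -> smooth2 g ->
  pdy (fun p => f p - g p) = fun p => pdy f p - pdy g p.
Proof.
move=> sf sg; apply/funext => -[x y]; rewrite {1}/pdy/= derive1E.
have hf := smooth2_is_derivey x y sf; have hg := smooth2_is_derivey x y sg.
exact: (@derive_val _ _ _ _ _ _ _ (is_deriveB hf hg)).
Qed.

(** The increments t and x - x' of the application have either sign, and the parameter s in [0, 1]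
    is what later exhibits the intermediate point as a convex combination. *)
Lemma mvt_unordered (f df : R -> R) (a b : R) : (forall x : R, is_derive x 1 f (df x)) ->
  exists2 s : R, 0 <= s <= 1 & f b - f a = df (a + s * (b - a)) * (b - a).
Proof.
move=> fd.
have fc x : {for x, continuous f}.
  by apply/differentiable_continuous/derivable1_diffP; case: (fd x).
have [->|ab] := eqVneq a b.
  by exists 0; rewrite ?subrr ?mulr0// lexx ler01.
wlog lab : a b ab / a < b.
  move=> W; have [lab|lba|/eqP] := ltgtP a b; [exact: W| |by rewrite (negbTE ab)].
  have ba : b != a by rewrite eq_sym.
  have [s /andP[s0 s1] e] := W _ _ ba lba.
  exists (1 - s); first by apply/andP; split; lra.
  rewrite (_ : a + _ = b + s * (a - b)); last by ring.
  by rewrite -[LHS]opprK opprB e; ring.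
have [c] := @MVT _ f df a b lab (fun x _ => fd x) (continuous_subspaceT fc).
rewrite in_itv/= => /andP[ac cb] e.
have ba : 0 < b - a by lra.
exists ((c - a) / (b - a)).
  apply/andP; split; first by rewrite divr_ge0//; lra.
  by rewrite ler_pdivrMr// mul1r; lra.
by rewrite e divfK ?gt_eqF// (addrC a) subrK.
Qed.

Lemma continuous_box V (p : R * R) (e : R) : continuous V -> 0 < e ->
  exists2 r : R, 0 < r & forall u v, `|u| <= r -> `|v| <= r ->
    `|V (p.1 + u, p.2 + v) - V p| <= e.
Proof.
move=> cV e0; have /cvgrPdist_le /(_ e e0) := cV p.
move=> /nbhs_ballP[r /= r0 h]; exists (r / 2); first by rewrite divr_gt0.
move=> u v ur vr; rewrite distrC; apply: h; split; rewrite /ball/=.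
  by rewrite opprD addNKr normrN; lra.
by rewrite opprD addNKr normrN; lra.
Qed.

(** The second difference of f over a square of side h is h^2 times either mixed derivative at some
    point of that square; continuity then compares both with their values at the corner. *)
Lemma schwarz f : smooth2 f -> pdx (pdy f) = pdy (pdx f).
Proof.
move=> sf; apply/funext => -[x y]; apply/eqP; rewrite -subr_eq0 -normr_eq0.
rewrite eq_le normr_ge0 andbT; apply/ler_addgt0Pl => e e0; rewrite addr0.
have e20 : 0 < e / 2 by rewrite divr_gt0.
have sx := smooth2_pdx sf; have sy := smooth2_pdy sf.
have [r r0 hr] := continuous_box (x, y) (smooth2_continuous (smooth2_pdx sy)) e20.
have [r' r'0 hr'] := continuous_box (x, y) (smooth2_continuous (smooth2_pdy sx)) e20.
have [h [h0 h1 h2]] : exists h : R, [/\ 0 < h, h <= r & h <= r'].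
  exists (Num.min r r'); rewrite lt_min r0 r'0 !ge_min !lexx orbT; split => //.
have sm (s : R) : 0 <= s <= 1 -> `|s * h| <= r /\ `|s * h| <= r'.
  move=> /andP[s0 s1]; rewrite normrM (ger0_norm s0) (gtr0_norm h0).
  have sh : s * h <= h by rewrite ler_piMl// ltW.
  by split; lra.
have dA (t : R) : is_derive t 1 (fun t => f (t, y + h) - f (t, y))
    (pdx f (t, y + h) - pdx f (t, y)).
  by apply: is_deriveB; exact: smooth2_is_derivex.
have dB (t : R) : is_derive t 1 (fun t => f (x + h, t) - f (x, t))
    (pdy f (x + h, t) - pdy f (x, t)).
  by apply: is_deriveB; exact: smooth2_is_derivey.
have [s hs eA] := mvt_unordered x (x + h) dA.
have [s' hs' eB] := mvt_unordered y (y + h) dB.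
have xh : x + h - x = h by ring.
have yh : y + h - y = h by ring.
rewrite xh in eA; rewrite yh in eB.
have [t ht eA'] := mvt_unordered y (y + h) (fun t => smooth2_is_derivey (x + s * h) t sx).
have [t' ht' eB'] := mvt_unordered x (x + h) (fun t => smooth2_is_derivex t (y + s' * h) sy).
rewrite yh in eA'; rewrite xh in eB'.
have E : pdy (pdx f) (x + s * h, y + t * h) = pdx (pdy f) (x + t' * h, y + s' * h).
  have DD (A1 A2 A3 A4 : R) : A1 - A2 - (A3 - A4) = A1 - A3 - (A2 - A4) by ring.
  have hn : h != 0 by rewrite gt_eqF.
  apply: (mulIf hn); apply: (mulIf hn).
  apply: etrans (esym (etrans eA (congr1 (fun z => z * h) eA'))) _.
  exact: etrans (DD _ _ _ _) (etrans eB (congr1 (fun z => z * h) eB')).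
have := hr _ _ (sm _ ht').1 (sm _ hs').1; rewrite /= -E.
have := hr' _ _ (sm _ hs).2 (sm _ ht).2; rewrite /=.
move: (pdy (pdx f) (x + s * h, y + t * h)) (pdy (pdx f) (x, y)) (pdx (pdy f) (x, y)) => a b c ab ac.
rewrite (_ : c - b = (a - b) - (a - c)); last by ring.
by apply: le_trans (ler_normB _ _) _; lra.
Qed.

(** [smooth2] gives partial derivatives only. The oblique increment is therefore split into a
    horizontal and a vertical one, each treated by the mean value theorem and the continuity of the
    partial derivative. *)
Lemma is_derive_antidiagonal V (t y s : R) : smooth2 V ->
  is_derive s 1 (fun s => V (t - s, y + s))
    (pdy V (t - s, y + s) - pdx V (t - s, y + s)).
Proof.
move=> sV.
have lim : (fun h : R => h^-1 *: ((fun s => V (t - s, y + s)) (h *: 1 + s) - V (t - s, y + s)))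
    @ 0^' --> pdy V (t - s, y + s) - pdx V (t - s, y + s).
  apply/cvgrPdist_le => e e0; have e20 : 0 < e / 2 by rewrite divr_gt0.
  have [r r0 hr] := continuous_box (t - s, y + s) (smooth2_continuous (smooth2_pdx sV)) e20.
  have [r' r'0 hr'] := continuous_box (t - s, y + s) (smooth2_continuous (smooth2_pdy sV)) e20.
  near=> h.
  have hn0 : h != 0 by near: h; exact: nbhs_dnbhs_neq.
  have h1 : `|h| <= r by near: h; exact: dnbhs0_le.
  have h2 : `|h| <= r' by near: h; exact: dnbhs0_le.
  have sm (a : R) : 0 <= a <= 1 -> `|a * h| <= r /\ `|a * h| <= r'.
    move=> /andP[a0 a1]; rewrite normrM (ger0_norm a0).
    have ah : a * `|h| <= `|h| by rewrite ler_piMl.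
    by split; lra.
  have [a /sm[ha _]] := mvt_unordered (t - s) (t - s - h)
    (fun x => smooth2_is_derivex x (y + s + h) sV).
  have [b /sm[_ hb]] := mvt_unordered (y + s) (y + s + h)
    (fun z => smooth2_is_derivey (t - s) z sV).
  rewrite /GRing.scale/= mulr1.
  have yh : y + s + h - (y + s) = h by ring.
  have xh : t - s - h - (t - s) = - h by ring.
  rewrite yh xh => e2 e1.
  rewrite (_ : V (t - (h + s), _) = V (t - s - h, y + s + h)); last first.
    by congr (V (_, _)); ring.
  rewrite (_ : _ - V (t - s, y + s) =
     (V (t - s - h, y + s + h) - V (t - s, y + s + h)) +
     (V (t - s, y + s + h) - V (t - s, y + s))); last by ring.
  rewrite e1 e2 mulrN.
  have := hr (- (a * h)) h; rewrite normrN => /(_ ha h1).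
  have := hr' 0 (b * h); rewrite normr0 addr0 => /(_ (ltW r'0) hb) /=.
  rewrite mulrN.
  move: (pdx V (t - s + - (a * h), y + s + h)) (pdy V (t - s, y + s + b * h)) (pdx V (t - s, y + s)) (pdy V (t - s, y + s)) => A B A0 B0 u v.
  rewrite (_ : _ - _ = (A - A0) - (B - B0)); last by field.
  by apply: le_trans (ler_normB _ _) _; lra.
apply: DeriveDef; first exact: (cvgP _ lim).
by apply: cvg_lim => //.
Unshelve. all: by end_near. Qed.

End Smooth.

(** * Oscillatory integrals in one variable *)

Section Amplitude.
Variable R : realType.

(** Amplitudes of height M varying at scale d. The powers of d make the class stable under products
    with a constant free of d. *)
Definition amp (d M : R) (u : R -> R) := exists u1 u2 : R -> R,
  [/\ forall y : R, is_derive y 1 u (u1 y), forall y : R, is_derive y 1 u1 (u2 y), continuous u2 &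
   forall y, [/\ `|u y| <= M, `|u1 y| <= M / d & `|u2 y| <= M / d ^+ 2]].

Lemma is_derive_continuous (f : R -> R) (x df : R) :
  is_derive x 1 f df -> {for x, continuous f}.
Proof. by move=> fd; apply/differentiable_continuous/derivable1_diffP; case: fd. Qed.

Lemma amp_continuous d M u : amp d M u -> continuous u.
Proof. by move=> [u1 [u2 [h _ _ _]]] x; exact: is_derive_continuous (h x). Qed.

Lemma amp_bound d M u : amp d M u -> forall x, `|u x| <= M.
Proof. by move=> [u1 [u2 [_ _ _ h]]] x; have [] := h x. Qed.

Lemma ampD d M M' u v : amp d M u -> amp d M' v -> amp d (M + M') (fun y => u y + v y).
Proof.
move=> [u1 [u2 [hu hu1 cu2 bu]]] [v1 [v2 [hv hv1 cv2 bv]]].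
exists (fun y => u1 y + v1 y), (fun y => u2 y + v2 y); split.
- by move=> y; exact: is_deriveD.
- by move=> y; exact: is_deriveD.
- by move=> y; exact: (cvgD (cu2 y) (cv2 y)).
- move=> y; have [a1 a2 a3] := bu y; have [b1 b2 b3] := bv y.
  by split; rewrite ?mulrDl; apply: le_trans (ler_normD _ _) (lerD _ _).
Qed.

Lemma ampN d M u : amp d M u -> amp d M (fun y => - u y).
Proof.
move=> [u1 [u2 [hu hu1 cu2 bu]]].
exists (fun y => - u1 y), (fun y => - u2 y); split.
- by move=> y; exact: is_deriveN.
- by move=> y; exact: is_deriveN.
- by move=> y; exact: (cvgN (cu2 y)).
- by move=> y; rewrite !normrN.
Qed.

(** The factor counts the 1 + 2 + 1 terms of the Leibniz formula for the second derivative. *)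
Lemma ampM d M M' u v : 0 < d -> amp d M u -> amp d M' v ->
  amp d (4 * (M * M')) (fun y => u y * v y).
Proof.
move=> d0 [u1 [u2 [hu hu1 cu2 bu]]] [v1 [v2 [hv hv1 cv2 bv]]].
exists (fun y => u y * v1 y + v y * u1 y),
  (fun y => (u y * v2 y + v1 y * u1 y) + (v y * u2 y + u1 y * v1 y)); split.
- by move=> y; exact: is_deriveM.
- by move=> y; apply: is_deriveD; exact: is_deriveM.
- have c (f df : R -> R) : (forall y : R, is_derive y 1 f (df y)) -> continuous f.
    by move=> h x; exact: is_derive_continuous (h x).
  have cu := c _ _ hu; have cv := c _ _ hv; have cu1 := c _ _ hu1; have cv1 := c _ _ hv1.
  move=> y; apply: cvgD; apply: cvgD; apply: cvgM;
    (exact: cu || exact: cv || exact: cu1 || exact: cv1 || exact: cu2 || exact: cv2).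
- move=> y; have [a1 a2 a3] := bu y; have [b1 b2 b3] := bv y.
  have M0 : 0 <= M := le_trans (normr_ge0 _) a1.
  have M'0 : 0 <= M' := le_trans (normr_ge0 _) b1.
  have h (p q A B : R) : `|p| <= A -> `|q| <= B -> `|p * q| <= A * B.
    by move=> ? ?; rewrite normrM ler_pM.
  have MM : 0 <= M * M' by exact: mulr_ge0.
  have MMd : 0 <= M * M' / d by apply: mulr_ge0 => //; rewrite invr_ge0 ltW.
  split.
  + by apply: le_trans (h _ _ _ _ a1 b1) _; lra.
  + apply: le_trans (ler_normD _ _) _.
    have := h _ _ _ _ a1 b2; have := h _ _ _ _ b1 a2.
    rewrite (_ : M' * (M / d) = M * M' / d); last by ring.
    rewrite (_ : M * (M' / d) = M * M' / d); last by ring.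
    by rewrite -mulrA; lra.
  + apply: le_trans (ler_normD _ _) _; apply: le_trans (lerD (ler_normD _ _) (ler_normD _ _)) _.
    have := h _ _ _ _ a1 b3; have := h _ _ _ _ b1 a3; have := h _ _ _ _ a2 b2; have := h _ _ _ _ b2 a2.
    rewrite (_ : M' * (M / d ^+ 2) = M * M' / d ^+ 2); last by ring.
    rewrite (_ : M * (M' / d ^+ 2) = M * M' / d ^+ 2); last by ring.
    have dn : d != 0 by rewrite gt_eqF.
    rewrite (_ : M' / d * (M / d) = M * M' / d ^+ 2); last by field.
    rewrite (_ : M / d * (M' / d) = M * M' / d ^+ 2); last by field.
    by rewrite -(mulrA 4); lra.
Qed.

Lemma amp_cst d M c : 0 < d -> `|c| <= M -> amp d M (fun _ => c).
Proof.
move=> d0 cM; have M0 := le_trans (normr_ge0 _) cM.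
exists (fun=> 0), (fun=> 0); split => [y|y|y|y].
- exact: is_derive_cst.
- exact: is_derive_cst.
- exact: cvg_cst.
- by rewrite normr0; split => //; rewrite divr_ge0// ltW// exprn_gt0.
Qed.

(** The support condition alone would permit a nonzero value at an end point; continuity excludes
    it, since g vanishes just outside. This kills the boundary terms of the integrations by
    parts. *)
Lemma continuous_boundary0 (g : R -> R) (a b : R) : continuous g ->
  (forall y, g y != 0 -> a <= y <= b) -> g a = 0 /\ g b = 0.
Proof.
move=> cg g0.
have away (x : R) : g x != 0 -> exists2 e : R, 0 < e & forall h, `|h| < e -> g (x + h) != 0.
  move=> gx; have /cvgrPdist_lt/(_ `|g x|) : g @ x --> g x by exact: cg.
  rewrite normr_gt0 => /(_ gx)/nbhs_ballP[e /= e0 h]; exists e => // t te.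
  apply/eqP => gt0; have := h (x + t); rewrite /ball/= gt0 subr0 ltxx.
  by rewrite opprD addNKr normrN => /(_ te).
split; apply/eqP; apply: contraT => /away[e e0 h].
  have /g0 : g (a + - (e / 2)) != 0 by apply: h; rewrite normrN gtr0_norm; lra.
  by move=> /andP[? _]; lra.
have /g0 : g (b + e / 2) != 0 by apply: h; rewrite gtr0_norm; lra.
by move=> /andP[_ ?]; lra.
Qed.

Lemma derive_support (g g1 : R -> R) (a b : R) : (forall y : R, is_derive y 1 g (g1 y)) ->
  (forall y, g y != 0 -> a <= y <= b) -> forall y, g1 y != 0 -> a <= y <= b.
Proof.
move=> gd g0 y; apply: contraNT => nyab; apply/eqP.
rewrite -(@derive_val _ _ _ _ _ _ _ (gd y)) -[RHS](@derive_cst _ R R 0 y 1).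
apply: near_eq_derive.
have : \forall z \near y, ~~ (a <= z <= b).
  move: nyab; rewrite negb_and -!ltNge => /orP[ya|yb].
    by near=> z; rewrite negb_and -!ltNge; apply/orP; left; near: z; exact: lt_nbhsl.
  by near=> z; rewrite negb_and -!ltNge; apply/orP; right; near: z; exact: lt_nbhsr.
apply: filterS => z; case: (eqVneq (g z) 0) => // /g0 -> //.
Unshelve. all: by end_near. Qed.

End Amplitude.

(** * A second-order van der Corput estimate *)

Section VanDerCorput.
Variable R : realType.
Notation mu := (@lebesgue_measure R).

Lemma Rintegral_itv_le (f : R -> R) (a b K : R) : a <= b -> continuous f ->
  (forall x, a <= x <= b -> `|f x| <= K) ->
  `|\int[mu]_(x in `[a, b]) f x| <= K * (b - a).
Proof.
move=> ab cf fK.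
have intf : mu.-integrable `[a, b] (EFin \o f).
  apply: continuous_compact_integrable; first exact: segment_compact.
  exact: continuous_subspaceT.
have intK : mu.-integrable `[a, b] (EFin \o cst K).
  apply: continuous_compact_integrable; first exact: segment_compact.
  by apply: continuous_subspaceT => x; exact: cvg_cst.
apply: le_trans (le_normr_Rintegral _ intf) _ => //.
apply: (@le_trans _ _ (\int[mu]_(x in `[a, b]) K)).
  by apply: (le_Rintegral _ (integrable_norm intf) intK) => // x; rewrite /= in_itv/=; exact: fK.
rewrite Rintegral_cst//= lebesgue_measure_itv/= lte_fin.
by case: ifPn => // /negbTE nab; rewrite mulr0 mulr_ge0// ?subr_ge0//; apply: le_trans (fK a _); rewrite ?lexx.
Qed.

Variables (u f f1 f2 f3 : R -> R) (d M nu B a b : R).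
Hypotheses (d0 : 0 < d) (B1 : 1 <= B) (hu : amp d M u)
  (df : forall y : R, is_derive y 1 f (f1 y)) (df1 : forall y : R, is_derive y 1 f1 (f2 y))
  (df2 : forall y : R, is_derive y 1 f2 (f3 y)) (cf3 : continuous f3)
  (u0 : forall y, u y != 0 -> a <= y <= b) (ab : a <= b) (bad : b - a <= d)
  (nu0 : 0 <= nu)
  (lbf : forall y, a <= y <= b ->
    [/\ nu <= `|f1 y|, `|f2 y| <= B * nu / d & `|f3 y| <= B * nu / d ^+ 2]).

Let M0 : 0 <= M. Proof. exact: le_trans (normr_ge0 _) (amp_bound hu 0). Qed.

Let cu : continuous u := amp_continuous hu.
Let cf : continuous f. Proof. by move=> y; exact: is_derive_continuous (df y). Qed.
Let cf1 : continuous f1. Proof. by move=> y; exact: is_derive_continuous (df1 y). Qed.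
Let cf2 : continuous f2. Proof. by move=> y; exact: is_derive_continuous (df2 y). Qed.
Let ccos : continuous (fun y => cos (f y)).
Proof. by move=> y; apply: (@continuous_comp _ _ _ f cos); [exact: cf|exact: continuous_cos]. Qed.
Let csin : continuous (fun y => sin (f y)).
Proof. by move=> y; apply: (@continuous_comp _ _ _ f sin); [exact: cf|exact: continuous_sin]. Qed.

Let I := \int[mu]_y (cos (f y) * u y).

Let I_itv : I = \int[mu]_(y in `[a, b]) (cos (f y) * u y).
Proof.
rewrite /I [RHS]Rintegral_mkcond; apply: eq_Rintegral => y _.
rewrite patchE; case: ifPn => //; rewrite notin_setE/= in_itv/= => yab.
by have [->|/u0//] := eqVneq (u y) 0; rewrite mulr0.
Qed.

Let I_trivial : `|I| <= M * d.
Proof.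
rewrite I_itv; apply: le_trans (@Rintegral_itv_le _ a b M ab _ _) _.
- by move=> y; apply: cvgM; [exact: ccos|exact: cu].
- move=> y _; rewrite normrM -[M]mul1r; apply: ler_pM => //; last exact: amp_bound hu y.
  by rewrite ler_norml cos_geN1 cos_le1.
- exact: ler_wpM2l.
Qed.

(* Integrating by parts twice amounts to the antiderivative
   [W = sin f * (u / f1) + cos f * (u / f1)' / f1] of [cos f * (u + E)], where
   [E] is [(f1^-1 d/dy)^2 u], written with [v = 1 / f1]. *)
Let I_parts : 0 < nu -> a < b ->
  `|I| <= 8 * B ^+ 2 * M / (d * nu) ^+ 2 * d.
Proof.
move=> nup ltab.
have [u1 [u2 [du du1 cu2 bu]]] := hu.
have cu1 : continuous u1 by move=> y; exact: is_derive_continuous (du1 y).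
pose v y := (f1 y)^-1.
have f1n y : a <= y <= b -> f1 y != 0.
  by move=> /lbf[h _ _]; rewrite -normr_gt0; exact: lt_le_trans h.
pose E y := u2 y * v y ^+ 2 - 3 * (u1 y * f2 y * v y ^+ 3) - u y * f3 y * v y ^+ 3
  + 3 * (u y * f2 y ^+ 2 * v y ^+ 4).
pose W y := sin (f y) * (u y * v y)
  + cos (f y) * (u1 y * (v y * v y) - u y * f2 y * (v y * v y * v y)).
have dv (y : R) : a <= y <= b -> is_derive y 1 v (- v y ^+ 2 * f2 y).
  move=> yab; have := is_deriveV (f1n y yab) (df1 y).
  by rewrite /v exprVn.
have dcos (y : R) : is_derive y 1 (fun y => cos (f y)) (- sin (f y) * f1 y).
  exact: (@is_derive1_comp _ cos f).
have dsin (y : R) : is_derive y 1 (fun y => sin (f y)) (cos (f y) * f1 y).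
  exact: (@is_derive1_comp _ sin f).
have dW (y : R) : a <= y <= b -> is_derive y 1 W (cos (f y) * (u y + E y)).
  move=> yab; have hv := dv y yab.
  have h1 := is_deriveM (dsin y) (is_deriveM (du y) hv).
  have hvv := is_deriveM hv hv.
  have h2 := is_deriveB (is_deriveM (du1 y) hvv)
    (is_deriveM (is_deriveM (du y) (df2 y)) (is_deriveM hvv hv)).
  have := is_deriveD h1 (is_deriveM (dcos y) h2).
  congr (is_derive y 1 _ _).
  rewrite !fctE /GRing.scale/= /E /v; field; exact: f1n.
have cv (y : R) : a <= y <= b -> {for y, continuous v}.
  by move=> yab; exact: is_derive_continuous (dv y yab).
have cexp (g : R -> R) n (y : R) : {for y, continuous g} -> {for y, continuous (fun y => g y ^+ n)}.
  move=> cg; apply: (@continuous_comp _ _ _ g (fun x => x ^+ n)) => //.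
  exact: exprn_continuous.
have cE (y : R) : a <= y <= b -> {for y, continuous E}.
  move=> yab; have h := cv y yab.
  apply: cvgD; [apply: cvgB; [apply: cvgB|]|].
  - by apply: cvgM; [exact: cu2|exact: cexp].
  - apply: cvgM; first exact: cvg_cst.
    by apply: cvgM; [apply: cvgM; [exact: cu1|exact: cf2]|exact: cexp].
  - by apply: cvgM; [apply: cvgM; [exact: cu|exact: cf3]|exact: cexp].
  - apply: cvgM; first exact: cvg_cst.
    by apply: cvgM; [apply: cvgM; [exact: cu|apply: cexp; exact: cf2]|exact: cexp].
have [ua ub] := continuous_boundary0 cu u0.
have [u1a u1b] := continuous_boundary0 cu1 (derive_support du u0).
have cwE : {within `[a, b], continuous (fun y => cos (f y) * (u y + E y))}.
  apply: continuous_in_subspaceT => y; rewrite inE/= in_itv/= => yab.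
  apply: cvgM; first exact: ccos.
  by apply: cvgD; [exact: cu|exact: cE].
(* Each term of W contains u or u', and both vanish at a and at b. *)
have FTC : \int[mu]_(y in `[a, b]) (cos (f y) * (u y + E y)) = 0.
  rewrite /Rintegral (@continuous_FTC2 _ _ W)//.
  - by rewrite /W ua ub u1a u1b !(mul0r, mulr0, subr0, addr0) -EFinB subrr.
  - split.
    + move=> y; rewrite in_itv/= => /andP[ay yb].
      have yab : a <= y <= b by rewrite !ltW.
      by have [] := dW y yab.
    + apply: cvg_at_right_filter; apply: is_derive_continuous; apply: dW.
      by rewrite lexx ltW.
    + apply: cvg_at_left_filter; apply: is_derive_continuous; apply: dW.
      by rewrite lexx ltW.
  - move=> y; rewrite in_itv/= => /andP[ay yb]; rewrite derive1E.
    by apply: derive_val; apply: dW; rewrite !ltW.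
have int1 : mu.-integrable `[a, b] (EFin \o (fun y => cos (f y) * (u y + E y))).
  by apply: continuous_compact_integrable => //; exact: segment_compact.
have int2 : mu.-integrable `[a, b] (EFin \o (fun y => cos (f y) * u y)).
  apply: continuous_compact_integrable; first exact: segment_compact.
  by apply: continuous_subspaceT => y; apply: cvgM; [exact: ccos|exact: cu].
have bE y : a <= y <= b -> `|cos (f y) * u y - cos (f y) * (u y + E y)| <= 8 * B ^+ 2 * M / (d * nu) ^+ 2.
  move=> yab; have [l1 l2 l3] := lbf yab; have [b1 b2 b3] := bu y.
  have fn := f1n y yab; have dn : d != 0 by rewrite gt_eqF.
  have nn : nu != 0 by rewrite gt_eqF.
  have vnu : `|v y * nu| <= 1.
    by rewrite normrM normfV (gtr0_norm nup) mulrC ler_pdivrMr ?mul1r ?normr_gt0.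
  (* Here p = d f'' / f' and q = d^2 f''' / f' are dimensionless and at most B. Up to the factor (nu
     / f')^2 <= 1, (d nu)^2 E consists of terms of size M, 3 M B, M B and 3 M B^2, together at most
     8 B^2 M. *)
  pose p := f2 y * d / nu * (v y * nu); pose q := f3 y * d ^+ 2 / nu * (v y * nu).
  have f2B : `|f2 y * d / nu| <= B.
    rewrite normrM normfV (gtr0_norm nup) ler_pdivrMr// normrM (gtr0_norm d0).
    by rewrite -ler_pdivlMr.
  have f3B : `|f3 y * d ^+ 2 / nu| <= B.
    rewrite normrM normfV (gtr0_norm nup) ler_pdivrMr// normrM (@gtr0_norm _ (d ^+ 2)) ?exprn_gt0//.
    by rewrite -ler_pdivlMr ?exprn_gt0.
  have B0 : 0 <= B := le_trans ler01 B1.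
  have h (x z X Z : R) : `|x| <= X -> `|z| <= Z -> `|x * z| <= X * Z.
    by move=> ? ?; rewrite normrM ler_pM.
  have pB : `|p| <= B by rewrite -[B]mulr1; exact: h.
  have qB : `|q| <= B by rewrite -[B]mulr1; exact: h.
  have u1M : `|u1 y * d| <= M by rewrite normrM (gtr0_norm d0) -ler_pdivlMr.
  have u2M : `|u2 y * d ^+ 2| <= M.
    by rewrite normrM (@gtr0_norm _ (d ^+ 2)) ?exprn_gt0// -ler_pdivlMr ?exprn_gt0.
  have -> : cos (f y) * u y - cos (f y) * (u y + E y) =
    cos (f y) * ((v y * nu) * (v y * nu)) * (- (u2 y * d ^+ 2 - 3 * (u1 y * d * p) - u y * q + 3 * (u y * (p * p))))
      / (d * nu) ^+ 2.
    by rewrite /E /p /q /v; field; rewrite fn dn nn.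
  rewrite normrM normfV (@gtr0_norm _ ((d * nu) ^+ 2)) ?exprn_gt0 ?mulr_gt0//.
  apply: ler_wpM2r; first by rewrite invr_ge0 sqr_ge0.
  rewrite normrM -[leRHS]mul1r; apply: ler_pM => //.
    rewrite -[leRHS]mulr1; apply: (h); first by rewrite ler_norml cos_geN1 cos_le1.
    by rewrite -[leRHS]mulr1; apply: (h).
  rewrite normrN.
  have e1 := h _ _ _ _ u1M pB; have e2 := h _ _ _ _ b1 qB; have e3 := h _ _ _ _ b1 (h _ _ _ _ pB pB).
  have MB : M * B <= M * (B * B) by rewrite ler_wpM2l// ler_peMl.
  have MB' : M <= M * (B * B) by rewrite ler_peMr// -[1]mulr1 ler_pM.
  apply: le_trans (ler_normD _ _) _; apply: le_trans (lerD (ler_normB _ _) (lexx _)) _.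
  apply: le_trans (lerD (lerD (ler_normB _ _) (lexx _)) (lexx _)) _.
  rewrite !(normrM 3) (ger0_norm (_ : 0 <= 3))// expr2 (mulrC _ M) (mulrCA M).
  have : 0 <= M * B by exact: mulr_ge0.
  lra.
rewrite I_itv -[X in `|X|]subr0 -FTC -RintegralB//.
apply: le_trans (le_normr_Rintegral _ (integrableB _ int2 int1)) _ => //.
have intK : mu.-integrable `[a, b] (EFin \o cst (8 * B ^+ 2 * M / (d * nu) ^+ 2)).
  apply: continuous_compact_integrable; first exact: segment_compact.
  by apply: continuous_subspaceT => x; exact: cvg_cst.
apply: (@le_trans _ _ (\int[mu]_(x in `[a, b]) (8 * B ^+ 2 * M / (d * nu) ^+ 2))).
  by apply: (le_Rintegral _ (integrable_norm (integrableB _ int2 int1)) intK).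
rewrite Rintegral_cst//= lebesgue_measure_itv/= lte_fin ltab/=.
apply: ler_wpM2l => //; apply: divr_ge0; last exact: sqr_ge0.
by apply: mulr_ge0 => //; apply: mulr_ge0 => //; exact: sqr_ge0.
Qed.

Lemma van_der_corput :
  `|\int[mu]_y (cos (f y) * u y)| <= 16 * B ^+ 2 * M * d / (1 + (d * nu) ^+ 2).
Proof.
have X0 : 0 <= (d * nu) ^+ 2 by rewrite exprn_ge0// mulr_ge0// ltW.
have X1 : 0 < 1 + (d * nu) ^+ 2 by lra.
have BB : 1 <= B ^+ 2 by rewrite exprn_ege1.
have Md : 0 <= M * d by rewrite mulr_ge0// ltW.
have BMd : M * d <= B ^+ 2 * (M * d) by rewrite ler_peMl.
have BMd0 : 0 <= B ^+ 2 * (M * d) by lra.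
rewrite ler_pdivlMr// -/I.
(* If d nu <= 1, the denominator is at most 2 and the trivial bound suffices; otherwise 1 + (d nu)^2
   <= 2 (d nu)^2 doubles the constant 8 of [I_parts]. *)
have [dnu|dnu] := lerP (d * nu) 1.
  have X2 : (d * nu) ^+ 2 <= 1 by rewrite exprn_ile1// mulr_ge0// ltW.
  apply: le_trans (ler_pM (normr_ge0 _) (ltW X1) I_trivial (_ : _ <= 2)) _; first lra.
  by rewrite -!mulrA; lra.
have nup : 0 < nu by rewrite -(pmulr_rgt0 _ d0); lra.
have X2 : 1 <= (d * nu) ^+ 2 by rewrite exprn_ege1// ltW.
have Xp : 0 < (d * nu) ^+ 2 by lra.
move: ab; rewrite le_eqVlt => /orP[/eqP eab|ltab].
  have -> : I = 0 by rewrite I_itv -eab set_itv1 Rintegral_set1.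
  by rewrite normr0 mul0r -!mulrA; lra.
apply: le_trans (ler_wpM2r (ltW X1) (I_parts nup ltab)) _.
rewrite (_ : _ * (1 + _) = (8 * (B ^+ 2 * (M * d))) * (1 + ((d * nu) ^+ 2)^-1)); last first.
  by field; rewrite !gt_eqF.
have : ((d * nu) ^+ 2)^-1 <= 1 by rewrite invf_le1.
set Y := _^-1 => Y1.
rewrite (_ : 16 * _ * _ * _ = (8 * (B ^+ 2 * (M * d))) * 2); last by ring.
by apply: ler_wpM2l; lra.
Qed.

End VanDerCorput.

(** * The phase *)

Section ComplexValued.
Variable R : realType.
Implicit Types z w : R[i].

Lemma cReM z w : complex.Re (z * w) = complex.Re z * complex.Re w - complex.Im z * complex.Im w.
Proof. by case: z => a b; case: w. Qed.

Lemma cImM z w : complex.Im (z * w) = complex.Re z * complex.Im w + complex.Im z * complex.Re w.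
Proof. by case: z => a b; case: w. Qed.

Lemma Re_conjc z : complex.Re (conjc z) = complex.Re z.
Proof. by case: z. Qed.

Lemma Im_conjc z : complex.Im (conjc z) = - complex.Im z.
Proof. by case: z. Qed.

Lemma cabsE z : cabs z = Num.sqrt (complex.Re z ^+ 2 + complex.Im z ^+ 2).
Proof. by case: z. Qed.

Lemma cabs_sqr z : cabs z ^+ 2 = complex.Re z ^+ 2 + complex.Im z ^+ 2.
Proof. by rewrite cabsE sqr_sqrtr// addr_ge0 ?sqr_ge0. Qed.

Lemma cabs_ge0 z : 0 <= cabs z.
Proof. by rewrite cabsE sqrtr_ge0. Qed.

Lemma cabsM z w : cabs (z * w) = cabs z * cabs w.
Proof. exact: Normc.normcM. Qed.

Lemma cabs_conjc z : cabs (conjc z) = cabs z.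
Proof. by rewrite !cabsE Re_conjc Im_conjc sqrrN. Qed.

Lemma cabs_expi (t : R) : cabs (expi t) = 1.
Proof. by rewrite cabsE /= cos2Dsin2 sqrtr1. Qed.

Lemma normr_Re_le z : `|complex.Re z| <= cabs z.
Proof. by rewrite cabsE -sqrtr_sqr ler_wsqrtr// lerDl sqr_ge0. Qed.

Lemma normr_Im_le z : `|complex.Im z| <= cabs z.
Proof. by rewrite cabsE -sqrtr_sqr ler_wsqrtr// lerDr sqr_ge0. Qed.

Lemma cabs_le z : cabs z <= `|complex.Re z| + `|complex.Im z|.
Proof.
rewrite -(@ler_pXn2r _ 2) ?nnegrE ?cabs_ge0 ?addr_ge0// cabs_sqr sqrrD !real_normK ?num_real//.
by rewrite lerD2r lerDl mulrn_wge0// mulr_ge0.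
Qed.

Lemma expiD (s t : R) : expi (s + t) = expi s * expi t.
Proof. by rewrite /expi cosD sinD; apply/eqP; rewrite eq_complex/=; apply/andP; split; apply/eqP; ring. Qed.

Lemma conjcM z w : conjc (z * w) = conjc z * conjc w.
Proof. exact: rmorphM. Qed.

Lemma conjc_expi (t : R) : conjc (expi t) = expi (- t).
Proof. by rewrite /expi/= cosN sinN. Qed.

Lemma Re_mul_conjc z w : complex.Re (z * conjc w) =
  complex.Re z * complex.Re w + complex.Im z * complex.Im w.
Proof. by rewrite cReM Re_conjc Im_conjc mulrN opprK. Qed.

Lemma complex_neq0 z : (complex.Re z != 0) || (complex.Im z != 0) -> z != 0.
Proof. by apply: contraTneq => ->/=; rewrite eqxx. Qed.

Definition camp (d M : R) (u : R -> R[i]) :=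
  amp d M (fun y => complex.Re (u y)) /\ amp d M (fun y => complex.Im (u y)).

Lemma camp_conjc d M u : camp d M u -> camp d M (fun y => conjc (u y)).
Proof.
move=> [ur ui]; split.
  by rewrite (_ : (fun y => _) = (fun y => complex.Re (u y)))//; apply/funext => y; rewrite Re_conjc.
rewrite (_ : (fun y => _) = (fun y => - complex.Im (u y))); first exact: ampN.
by apply/funext => y; rewrite Im_conjc.
Qed.

(** Real and imaginary parts of the product are each made of two real products, and each of these
    costs the factor 4 of [ampM]. *)
Lemma campM d M M' u v : 0 < d -> camp d M u -> camp d M' v ->
  camp d (8 * (M * M')) (fun y => u y * v y).
Proof.
move=> d0 [ur ui] [vr vi]; rewrite (_ : 8 * (M * M') = 4 * (M * M') + 4 * (M * M')); last by ring.
split.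
  under eq_fun do rewrite cReM.
  by apply: ampD; [exact: ampM|apply: ampN; exact: ampM].
under eq_fun do rewrite cImM.
by apply: ampD; exact: ampM.
Qed.

Lemma camp_cst d c : 0 < d -> camp d (cabs c) (fun _ => c).
Proof.
move=> d0; split; apply: amp_cst => //; [exact: normr_Re_le|exact: normr_Im_le].
Qed.

End ComplexValued.

(** * Differences of the phase *)

Section Phase.
Variable R : realType.
Implicit Types S V : R * R -> R.

Lemma smooth2_is_derivey_shift V (x y t : R) : smooth2 V ->
  is_derive y 1 (fun z => V (x, z + t)) (pdy V (x, y + t)).
Proof.
move=> sV; rewrite -[pdy V _]mulr1.
apply: (@is_derive1_comp _ (fun z => V (x, z)) (fun z => z + t)).
  exact: smooth2_is_derivey.
by rewrite -[1 in X in is_derive _ _ _ X]addr0; apply: is_deriveD.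
Qed.

(** P with its derivatives reordered: the mixed derivative of V differentiated along (1, -1), which
    is the form that differencing along (-t, t) produces. *)
Definition rotational V := fun p => pdx (pdx (pdy V)) p - pdy (pdx (pdy V)) p.

Lemma rotationalE V : smooth2 V ->
  pdx (pdy (fun p => pdx V p - pdy V p)) = rotational V.
Proof.
move=> sV; have sx := smooth2_pdx sV; have sy := smooth2_pdy sV.
rewrite pdyB// pdxB; [|exact: smooth2_pdy..].
have e1 := congr1 (@pdx R) (esym (schwarz sV)).
by apply/funext => p; exact: (congr2 (fun F G => F p - G p) e1 (schwarz sy)).
Qed.

(** Since [pdy] commutes with this operator, the bounds on the y-derivatives of P become bounds on
    the same operator applied to y-derivatives of S, and one mean value formula handles the first
    three derivatives of the phase. *)
Lemma pdy_rotational V : smooth2 V -> pdy (rotational V) = rotational (pdy V).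
Proof.
move=> sV; have sy := smooth2_pdy sV; have se := smooth2_pdx sy.
rewrite /rotational pdyB; [|exact: smooth2_pdx|exact: smooth2_pdy].
have e1 := etrans (esym (schwarz se)) (congr1 (@pdx R) (esym (schwarz sy))).
have e2 := congr1 (@pdy R) (esym (schwarz sy)).
by apply/funext => p; exact: (congr2 (fun F G => F p - G p) e1 e2).
Qed.

(** For V = S this is U(x, y) - U(x', y), the phase left after both TT* steps. *)
Definition diff4 V (x x' t y : R) :=
  V (x, y) - V (x - t, y + t) - (V (x', y) - V (x' - t, y + t)).

Lemma diff4_is_derive V (x x' t y : R) : smooth2 V ->
  is_derive y 1 (diff4 V x x' t) (diff4 (pdy V) x x' t y).
Proof.
move=> sV; apply: is_deriveB; apply: is_deriveB;
  (exact: smooth2_is_derivey || exact: smooth2_is_derivey_shift).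
Qed.

(* two applications of the mean value theorem, along x and along the antidiagonal *)
Lemma diff4_pdy_mvt V (x x' t y : R) : smooth2 V -> exists r s, [/\ 0 <= r <= 1, 0 <= s <= 1 &
  diff4 (pdy V) x x' t y =
  t * (x - x') * rotational V (x' + r * (x - x') - s * t, y + s * t)].
Proof.
move=> sV; have sy := smooth2_pdy sV; have se := smooth2_pdx sy.
have dh (z : R) : is_derive z 1 (fun z => pdy V (z, y) - pdy V (z - t, y + t))
    (pdx (pdy V) (z, y) - pdx (pdy V) (z - t, y + t)).
  apply: is_deriveB; first exact: smooth2_is_derivex.
  rewrite -[X in is_derive _ _ _ X]mulr1.
  apply: (@is_derive1_comp _ (fun z => pdy V (z, y + t)) (fun z => z - t)).
    exact: smooth2_is_derivex.
  by rewrite -[1 in X in is_derive _ _ _ X]addr0; apply: is_deriveD.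
have [r r01 er] := mvt_unordered x' x dh.
have [s s01 es] := mvt_unordered 0 t (fun s => is_derive_antidiagonal (x' + r * (x - x')) y s se).
exists r, s; split => //; rewrite /diff4 er.
rewrite !subr0 !addr0 add0r in es.
(* Two signs cancel: the difference is taken backwards along (-1, 1), and [rotational]
   differentiates along (1, -1). *)
rewrite -[pdx _ (_, y) - _]opprB es /rotational; ring.
Qed.

Lemma convex2_Conv (X : set (R * R)) : convex2 (Conv X).
Proof.
by move=> u v hu hv t t01 K cK XK; exact: (cK _ _ (hu K cK XK) (hv K cK XK) t t01).
Qed.

Lemma sub_Conv (X : set (R * R)) : X `<=` Conv X.
Proof. by move=> p Xp K _; exact. Qed.

End Phase.

(** * The kernel of the second TT* step *)

Section KernelEstimate.
Local Opaque pdx pdy.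
Variable R : realType.
Notation mu := (@lebesgue_measure R).
Variables (C0 d2 m : R) (I J : set R) (a : R * R -> R[i]) (S : R * R -> R).
Hypotheses (hC0 : 1 <= C0) (d20 : 0 < d2) (m0 : 0 < m)
  (hJ : forall u v, J u -> J v -> `|u - v| <= d2)
  (sa : csmooth2 a) (suppa : supp a `<=` I `*` J)
  (a0 : forall p, cabs (a p) <= C0)
  (a1 : forall p, cabs (cpdy a p) <= C0 / d2)
  (a2 : forall p, cabs (cpdy (cpdy a) p) <= C0 / d2 ^+ 2)
  (sS : smooth2 S)
  (hP : forall p, Conv (supp a) p ->
     [/\ C0^-1 * m <= `|rotational S p|, `|rotational (pdy S) p| <= C0 * m / d2
       & `|rotational (pdy (pdy S)) p| <= C0 * m / d2 ^+ 2]).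

Lemma camp_slice (x t : R) : camp d2 C0 (fun y => a (x, y + t)).
Proof.
have [sr si] := sa; split.
  exists (fun y => pdy (fun q => complex.Re (a q)) (x, y + t)),
    (fun y => pdy (pdy (fun q => complex.Re (a q))) (x, y + t)); split.
  - by move=> y; exact: (smooth2_is_derivey_shift x y t sr).
  - by move=> y; exact: (smooth2_is_derivey_shift x y t (smooth2_pdy sr)).
  - move=> y; apply: is_derive_continuous.
    exact: (smooth2_is_derivey_shift x y t (smooth2_pdy (smooth2_pdy sr))).
  - move=> y; split; [exact: le_trans (normr_Re_le _) (a0 (x, y + t))|
      exact: le_trans (normr_Re_le _) (a1 (x, y + t))|
      exact: le_trans (normr_Re_le _) (a2 (x, y + t))].
exists (fun y => pdy (fun q => complex.Im (a q)) (x, y + t)),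
  (fun y => pdy (pdy (fun q => complex.Im (a q))) (x, y + t)); split.
- by move=> y; exact: (smooth2_is_derivey_shift x y t si).
- by move=> y; exact: (smooth2_is_derivey_shift x y t (smooth2_pdy si)).
- move=> y; apply: is_derive_continuous.
  exact: (smooth2_is_derivey_shift x y t (smooth2_pdy (smooth2_pdy si))).
- move=> y; split; [exact: le_trans (normr_Im_le _) (a0 (x, y + t))|
    exact: le_trans (normr_Im_le _) (a1 (x, y + t))|
    exact: le_trans (normr_Im_le _) (a2 (x, y + t))].
Qed.

Lemma supp_neq0 p : a p != 0 -> supp a p.
Proof. by move=> ap; apply: subset_closure. Qed.

Variables (lam t x x' : R).

Let A y := a (x, y) * conjc (a (x - t, y + t)) * conjc (a (x', y) * conjc (a (x' - t, y + t))).

(** Defined with the closed support instead of a != 0, so that Z is closed and contains its extreme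
    points. *)
Let Z := [set y | [/\ supp a (x, y), supp a (x - t, y + t), supp a (x', y) & supp a (x' - t, y + t)]].

Let Z_closed : closed Z.
Proof.
have h (z s : R) : closed [set y | supp a (z, y + s)].
  apply: (@preimage_closed _ _ (fun y => (z, y + s)) (supp a)).
    move=> y _.
    move=> U [[B C] [/= nB nC] BC].
    have : \forall w \near y, C (w + s) by exact: (cvgD cvg_id (cvg_cst s)).
    by apply: filterS => w Cw /=; apply: BC; split => //=; exact: nbhs_singleton.
  exact: closed_closure.
rewrite (_ : Z = [set y | supp a (x, y + 0)] `&` [set y | supp a (x - t, y + t)] `&`
  ([set y | supp a (x', y + 0)] `&` [set y | supp a (x' - t, y + t)])).
  exact: (closedI (closedI (h _ _) (h _ _)) (closedI (h _ _) (h _ _))).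
by apply/seteqP; split => y; rewrite /Z/= addr0; [case|case=> -[? ?] [? ?]].
Qed.

Let A_neq0 y : A y != 0 -> Z y.
Proof.
rewrite /A !(mulf_eq0, fmorph_eq0, negb_or) => /andP[/andP[h1 h2] /andP[h3 h4]].
by split; exact: supp_neq0.
Qed.

(** Three multiplications at a factor 8 each give 512. *)
Let A_camp : camp d2 (512 * C0 ^+ 4) A.
Proof.
have h (z s : R) := camp_slice z s.
have h0 (z : R) : camp d2 C0 (fun y => a (z, y)).
  by rewrite (_ : (fun y => _) = (fun y => a (z, y + 0)))//; apply/funext => y; rewrite addr0.
rewrite (_ : 512 * C0 ^+ 4 = 8 * (8 * (C0 * C0) * (8 * (C0 * C0)))); last by ring.
apply: campM => //; last apply: camp_conjc.
  by apply: campM => //; apply: camp_conjc.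
by apply: campM => //; apply: camp_conjc.
Qed.

Let nu := `|lam * t * (x - x')| * (m / C0).

(* [16 B^2 M] with [B = C0^2] and twice the amplitude bound [M = 8 |c| 512 C0^4] *)
Definition Kcst := 256 * 512 * C0 ^+ 8.

Lemma Kcst_gt0 : 0 < Kcst.
Proof. by rewrite /Kcst mulr_gt0// exprn_gt0// (lt_le_trans ltr01). Qed.

(** Let [l, b] be the smallest interval containing Z. Its ends belong to Z, so its length is at most
    d2 by the hypothesis on J, and all points at which P is evaluated over it lie in Conv(supp a).
    There the derivative of the phase is at least nu, and [van_der_corput] applies to both parts of
    the amplitude. *)
Lemma kernel_estimate (c : R[i]) :
  `|\int[mu]_y complex.Re (c * expi (lam * diff4 S x x' t y) * A y)|
    <= cabs c * (Kcst * d2 / (1 + (d2 * nu) ^+ 2)).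
Proof.
have C0p : 0 < C0 by apply: lt_le_trans hC0.
have [Z0|/set0P Zne] := eqVneq Z set0.
  rewrite (_ : \int[mu]_y _ = 0) ?normr0.
    apply: mulr_ge0; first exact: cabs_ge0.
    apply: divr_ge0; last by rewrite addr_ge0 ?sqr_ge0.
    by apply: mulr_ge0; rewrite ?ltW// Kcst_gt0.
  rewrite -[RHS](mul0r (fine (mu setT))) -Rintegral_cst//; apply: eq_Rintegral => y _.
  have [->|/A_neq0] := eqVneq (A y) 0; first by rewrite mulr0.
  by rewrite Z0.
have Zd y z : Z y -> Z z -> `|y - z| <= d2.
  move=> [/suppa[/= _ Jy] _ _ _] [/suppa[/= _ Jz] _ _ _]; exact: hJ.
have [y0 Zy0] := Zne.
have Zub : has_ubound Z.
  by exists (y0 + d2) => y Zy; have := Zd _ _ Zy Zy0; rewrite ler_norml => /andP[_]; lra.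
have Zlb : has_lbound Z.
  by exists (y0 - d2) => y Zy; have := Zd _ _ Zy Zy0; rewrite ler_norml => /andP[? _]; lra.
have [b [Zb bmax]] : exists b, Z b /\ forall y, Z y -> y <= b.
  exists (sup Z); split; last by move=> y Zy; exact: ub_le_sup.
  by have := closure_sup Zne Zub; rewrite -(closure_id _).1.
have [l [Zl lmin]] : exists l, Z l /\ forall y, Z y -> l <= y.
  exists (inf Z); split; last by move=> y Zy; exact: ge_inf.
  apply: Z_closed => U /nbhs_ballP[e /= e0 eU].
  have [z Zz ze] := inf_adherent e0 (conj Zne Zlb).
  exists z; split => //; apply: eU; rewrite /ball/=.
  have zi : inf Z <= z by exact: ge_inf.
  by rewrite ltr_norml; apply/andP; split; lra.
have lb : l <= b by exact: bmax.
have bl : b - l <= d2 by apply: le_trans (ler_norm _) (Zd _ _ Zb Zl).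
have seg (z s y : R) : supp a (z, l + s) -> supp a (z, b + s) -> l <= y <= b ->
    Conv (supp a) (z, y + s).
  move=> hl hb /andP[ly yb].
  move: lb; rewrite le_eqVlt => /orP[/eqP e|ltlb].
    have -> : y = l by apply/eqP; rewrite eq_le ly andbT e.
    exact: sub_Conv.
  have := convex2_Conv (sub_Conv hl) (sub_Conv hb) (t := (y - l) / (b - l)).
  rewrite /= => H; have bl0 : 0 < b - l by rewrite subr_gt0.
  have -> : (z, y + s) = ((1 - (y - l) / (b - l)) * z + (y - l) / (b - l) * z,
     (1 - (y - l) / (b - l)) * (l + s) + (y - l) / (b - l) * (b + s)).
    by congr (_, _); field; rewrite gt_eqF.
  apply: H; apply/andP; split; first by rewrite divr_ge0 ?(ltW bl0)// subr_ge0.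
  by rewrite ler_pdivrMr// mul1r lerD2r.
(* Interpolate between the ends l and b on each of the four vertical lines, then between x' and x
   with weight r, then along the antidiagonal with weight s. *)
have box (r s y : R) : 0 <= r <= 1 -> 0 <= s <= 1 -> l <= y <= b ->
    Conv (supp a) (x' + r * (x - x') - s * t, y + s * t).
  move=> r01 s01 yab.
  have [Zl1 Zl2 Zl3 Zl4] := Zl; have [Zb1 Zb2 Zb3 Zb4] := Zb.
  have Zc (z : R) : supp a (z, l) -> supp a (z, b) -> Conv (supp a) (z, y).
    by rewrite -[y]addr0 -[l in X in X -> _]addr0 -[b in X in _ -> X -> _]addr0 => h1 h2; exact: seg.
  have P1 := convex2_Conv (Zc _ Zl3 Zb3) (Zc _ Zl1 Zb1) r01.
  have P2 := convex2_Conv (seg _ _ _ Zl4 Zb4 yab) (seg _ _ _ Zl2 Zb2 yab) r01.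
  have -> : (x' + r * (x - x') - s * t, y + s * t) =
      ((1 - s) * ((1 - r) * x' + r * x) + s * ((1 - r) * (x' - t) + r * (x - t)),
       (1 - s) * ((1 - r) * y + r * y) + s * ((1 - r) * (y + t) + r * (y + t))).
    by congr (_, _); ring.
  exact: (convex2_Conv P1 P2 s01).
pose f V := fun y => lam * diff4 V x x' t y.
have df V (y : R) : smooth2 V -> is_derive y 1 (f V) (f (pdy V) y).
  by move=> sV; exact: (is_deriveZ lam (diff4_is_derive x x' t y sV)).
have nu0 : 0 <= nu by rewrite mulr_ge0// divr_ge0// ltW.
have fE V y : smooth2 V -> l <= y <= b -> exists2 p, Conv (supp a) p &
    `|f (pdy V) y| = `|lam * t * (x - x')| * `|rotational V p|.
  move=> sV yab; have [r [s [r01 s01 e]]] := diff4_pdy_mvt x x' t y sV.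
  exists (x' + r * (x - x') - s * t, y + s * t); first exact: box.
  by rewrite /f e -normrM !mulrA.
have sS1 := smooth2_pdy sS; have sS2 := smooth2_pdy sS1; have sS3 := smooth2_pdy sS2.
have df0 y := df _ y sS; have df1 y := df _ y sS1; have df2 y := df _ y sS2.
(* This turns the upper bounds C0 m / d2^j for P into C0^2 nu / d2^j, so that B = C0^2 in
   [van_der_corput]. *)
have nuE : `|lam * t * (x - x')| = nu * C0 / m.
  by rewrite /nu; field; rewrite !gt_eqF.
have bds y : l <= y <= b -> [/\ nu <= `|f (pdy S) y|,
    `|f (pdy (pdy S)) y| <= C0 ^+ 2 * nu / d2 &
    `|f (pdy (pdy (pdy S))) y| <= C0 ^+ 2 * nu / d2 ^+ 2].
  move=> yab; have [p1 /hP[h1 _ _] e1] := fE _ y sS yab.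
  have [p2 /hP[_ h2 _] e2] := fE _ y sS1 yab; have [p3 /hP[_ _ h3] e3] := fE _ y sS2 yab.
  have leE (u v : R) : u = v -> u <= v by move=> ->.
  have nuC (X Y : R) : X <= C0 * m / Y -> 0 < Y -> `|lam * t * (x - x')| * X <= C0 ^+ 2 * nu / Y.
    move=> XY Y0; apply: le_trans (ler_wpM2l (normr_ge0 _) XY) _; rewrite nuE; apply: leE.
    by field; rewrite !gt_eqF.
  split.
  - by apply: le_trans (leE _ _ (esym e1)); apply: ler_wpM2l => //; rewrite mulrC.
  - by apply: le_trans (leE _ _ e2) _; exact: nuC.
  - by apply: le_trans (leE _ _ e3) _; apply: nuC => //; rewrite exprn_gt0.
have cf3 : continuous (f (pdy (pdy (pdy S)))) by move=> y; exact: is_derive_continuous (df _ y sS3).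
have [ur ui] := campM d20 (camp_cst c d20) A_camp.
have u0 y : c * A y != 0 -> l <= y <= b.
  by rewrite mulf_eq0 negb_or => /andP[_ /A_neq0 Zy]; rewrite lmin ?bmax.
have B1 : 1 <= C0 ^+ 2 by rewrite exprn_ege1.
set M := 8 * _ in ur ui.
have vr := van_der_corput d20 B1 ur df0 df1 df2 cf3
  (fun y h => u0 y (complex_neq0 (introT orP (or_introl h)))) lb bl nu0 bds.
(* As cos(f - pi/2) = sin f, the estimate for cosines also covers the sine that multiplies the
   imaginary part. *)
pose g y := f S y - pi / 2.
have dg (y : R) : is_derive y 1 g (f (pdy S) y).
  by rewrite -[f (pdy S) y]subr0; apply: is_deriveB.
have vi := van_der_corput d20 B1 ui dg df1 df2 cf3
  (fun y h => u0 y (complex_neq0 (introT orP (or_intror h)))) lb bl nu0 bds.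
have cont_int (phi u : R -> R) : continuous phi -> amp d2 M u -> (forall y, u y != 0 -> l <= y <= b) ->
    nice mu (fun y => cos (phi y) * u y).
  move=> cphi ua us.
  apply: (@box_nice _ _ M (`|l| + `|b|)) => [|y|y].
  - apply: continuous_measurable_fun => y; apply: cvgM.
      by apply: (@continuous_comp _ _ _ phi cos); [exact: cphi|exact: continuous_cos].
    exact: amp_continuous ua y.
  - rewrite normrM -[M]mul1r; apply: ler_pM => //; last exact: amp_bound ua y.
    by rewrite ler_norml cos_geN1 cos_le1.
  - rewrite mulf_eq0 negb_or => /andP[_ /us /andP[ly yb]].
    by rewrite ler_norml; apply/andP; split; have := ler_norm b; have := ler_norm (- l);
      rewrite normrN; have := normr_ge0 b; have := normr_ge0 l; lra.
have cf0 : continuous (f S) by move=> y; exact: is_derive_continuous (df0 y).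
have cg : continuous g by move=> y; exact: is_derive_continuous (dg y).
have nr := cont_int _ _ cf0 ur (fun y h => u0 y (complex_neq0 (introT orP (or_introl h)))).
have ni := cont_int _ _ cg ui (fun y h => u0 y (complex_neq0 (introT orP (or_intror h)))).
rewrite (_ : \int[mu]_y _ = \int[mu]_y (cos (f S y) * complex.Re (c * A y)) -
  ( \int[mu]_y (cos (g y) * complex.Im (c * A y)))); last first.
  rewrite -(mulN1r (\int[mu]_y (cos (g y) * _))) -nice_RintegralZ// -nice_RintegralD//; last exact: niceZ.
  apply: eq_Rintegral => y _; rewrite -mulrA (mulrCA c) [LHS]cReM /=.
  by rewrite /g cosB cos_pihalf sin_pihalf mulr0 mulr1 add0r mulN1r.
apply: le_trans (ler_normB _ _) _; apply: le_trans (lerD vr vi) _.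
rewrite le_eqVlt; apply/orP; left; apply/eqP; rewrite /M /Kcst; field.
have : 0 <= (d2 * nu) ^+ 2 by exact: sqr_ge0.
by move=> h; rewrite gt_eqF//; lra.
Qed.

End KernelEstimate.

(** * TT* for complex-valued functions, and correlation integrals *)

Section ComplexTTstar.
Variable R : realType.
Notation mu := (@lebesgue_measure R).
Notation mu2 := (mu \x mu)%E.
Notation T1 := (measurableTypeR R).
Notation T2 := (T1 * T1)%type.

Definition cmeas {d} {T : measurableType d} (f : T -> R[i]) :=
  measurable_fun setT (fun x => complex.Re (f x)) /\
  measurable_fun setT (fun x => complex.Im (f x)).

Lemma cmeasM {d} {T : measurableType d} (f g : T -> R[i]) :
  cmeas f -> cmeas g -> cmeas (fun x => f x * g x).
Proof.
move=> [fr fi] [gr gi]; split.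
  under eq_fun do rewrite cReM.
  by apply: measurable_funB; exact: measurable_funM.
under eq_fun do rewrite cImM.
by apply: measurable_funD; exact: measurable_funM.
Qed.

Lemma cmeas_conjc {d} {T : measurableType d} (f : T -> R[i]) :
  cmeas f -> cmeas (fun x => conjc (f x)).
Proof.
move=> [fr fi]; split; first by under eq_fun do rewrite Re_conjc.
under eq_fun do rewrite Im_conjc.
exact: measurableT_comp.
Qed.

Lemma cmeas_comp {d d'} {T : measurableType d} {U : measurableType d'} (f : T -> R[i])
  (h : U -> T) : cmeas f -> measurable_fun setT h -> cmeas (fun x => f (h x)).
Proof. by move=> [fr fi] mh; split; [exact: (measurableT_comp fr)|exact: (measurableT_comp fi)]. Qed.

Lemma cmeas_expi {d} {T : measurableType d} (f : T -> R) :
  measurable_fun setT f -> cmeas (fun x => expi (f x)).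
Proof.
move=> mf; split => /=.
  by apply: (measurableT_comp _ mf); apply: continuous_measurable_fun; exact: continuous_cos.
by apply: (measurableT_comp _ mf); apply: continuous_measurable_fun; exact: continuous_sin.
Qed.

Lemma measurable_cabs_sqr {d} {T : measurableType d} (f : T -> R[i]) :
  cmeas f -> measurable_fun setT (fun x => cabs (f x) ^+ 2).
Proof.
move=> [fr fi]; under eq_fun do rewrite cabs_sqr.
by apply: measurable_funD; exact: measurable_funX.
Qed.

Lemma measurable_cabs {d} {T : measurableType d} (f : T -> R[i]) :
  cmeas f -> measurable_fun setT (fun x => cabs (f x)).
Proof.
move=> mf; under eq_fun do rewrite cabsE -cabs_sqr.
by apply: measurableT_comp; [apply: continuous_measurable_fun; exact: sqrt_continuous|exact: measurable_cabs_sqr].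
Qed.

(** J and L are given through equations, so that the integrals may be presented after a change of
    variables. *)
Lemma cTTstar (g : T1 -> R[i]) (k : T2 -> R[i]) (M N : R) : cmeas g -> cmeas k ->
  (forall x, cabs (g x) <= M) -> (forall p, cabs (k p) <= M) ->
  (forall x, g x != 0 -> `|x| <= N) ->
  (forall x y, k (x, y) != 0 -> `|x| <= N /\ `|y| <= N) ->
  forall (J : R -> R) (L : R),
  (forall t, J t = \int[mu2]_p complex.Re (k p * conjc (k (p.1, p.2 + t)))) ->
  L = \int[mu2]_p complex.Re (g p.1 * k p) ->
  nice mu J /\ L ^+ 2 <= (\int[mu]_x cabs (g x) ^+ 2) * \int[mu]_t J t.
Proof.
move=> [mgr mgi] [mkr mki] gM kM g0 k0 J L JE ->.
have := @TTstar R _ _ _ _ M N mgr mgi mkr mki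
 (fun x => le_trans (normr_Re_le _) (gM x)) (fun x => le_trans (normr_Im_le _) (gM x))
 (fun x => le_trans (normr_Re_le _) (kM x)) (fun x => le_trans (normr_Im_le _) (kM x))
 (fun x h => g0 _ (complex_neq0 (introT orP (or_introl h))))
 (fun x h => g0 _ (complex_neq0 (introT orP (or_intror h))))
 (fun x y h => k0 _ _ (complex_neq0 (introT orP (or_introl h))))
 (fun x y h => k0 _ _ (complex_neq0 (introT orP (or_intror h)))).
set J' := (fun t : R => _).
have -> : J' = J.
  by apply/funext => t; rewrite JE; apply: eq_Rintegral => p _; rewrite Re_mul_conjc.
move=> [nJ h]; split => //; move: h.
congr (_ ^+ 2 <= _ * _); first by apply: eq_Rintegral => p _; rewrite cReM.
by apply: eq_Rintegral => x _; rewrite cabs_sqr.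
Qed.

Lemma nice_opp {d} {T : measurableType d} (m : {measure set T -> \bar R}) (f : T -> R) :
  nice m f -> nice m (fun x => - f x).
Proof. by move=> /(niceZ (-1)); under eq_fun do rewrite mulN1r. Qed.

(** The antiderivative (D / k) atan(k x) increases by less than D pi / k on any window, so B, which
    grows with the supports, disappears. *)
Lemma Rintegral_atan_le (D k B : R) : 0 <= D -> 0 < k -> 0 < B ->
  \int[mu]_(x in `[- B, B]) (D / (1 + (k * x) ^+ 2)) <= D * pi / k.
Proof.
move=> D0 k0 B0; have Bl : - B < B by lra.
have df (x : R) : is_derive x 1 (fun x => D / k * atan (k * x)) (D / (1 + (k * x) ^+ 2)).
  have h : is_derive x 1 (fun x => k * x) k.
    by rewrite -[X in is_derive _ _ _ X]mulr1; apply: is_deriveZ.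
  have := is_deriveZ (D / k) (@is_derive1_comp _ atan (fun x => k * x) x _ _ (is_derive1_atan _) h).
  congr (is_derive x 1 _ _); rewrite /GRing.scale/=; field.
  rewrite (gt_eqF k0) gt_eqF//.
  by have := sqr_ge0 (k * x); rewrite exprMn; lra.
have dc (x : R) : {for x, continuous (fun x => D / k * atan (k * x))} := is_derive_continuous (df x).
rewrite /Rintegral (@continuous_FTC2 _ _ (fun x => D / k * atan (k * x)))//.
- rewrite -EFinB/= -mulrBr -mulrA (mulrC pi) mulrA.
  apply: ler_wpM2l; first by rewrite divr_ge0// ltW.
  have := atan_ltpi2 (k * B); have := atan_gtNpi2 (k * - B); lra.
- apply: continuous_subspaceT => x; apply: cvgM; first exact: cvg_cst.
  apply: cvgV; first by rewrite gt_eqF//; have := sqr_ge0 (k * x); lra.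
  apply: cvgD; first exact: cvg_cst.
  apply: (@continuous_comp _ _ _ (fun x => k * x) (fun x => x ^+ 2)); last exact: exprn_continuous.
  exact: mulrl_continuous.
- split.
  + by move=> x _; case: (df x).
  + by apply: cvg_at_right_filter; exact: dc.
  + by apply: cvg_at_left_filter; exact: dc.
- by move=> x _; rewrite derive1E; apply: derive_val.
Qed.

Lemma nice_prod (p q : T1 -> R) : nice mu p -> nice mu q ->
  nice2 mu mu (fun z : T2 => p z.1 * q z.2).
Proof.
move=> [mp [M [D [mD Doo pM p0]]]] [mq [M' [D' [mD' D'oo qM q0]]]]; split.
  apply: measurable_funM; first exact: (measurableT_comp mp measurable_fst).
  exact: (measurableT_comp mq measurable_snd).
exists (M * M'), D, D'; split => //; split => [z|x y /= nxy].
  by rewrite normrM ler_pM.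
case: (pselect (D x)) => Dx; last by rewrite p0// mul0r.
by rewrite q0 ?mulr0// => Dy; exact: nxy.
Qed.

Lemma Rintegral_prod (p q : T1 -> R) : nice mu p -> nice mu q ->
  \int[mu2]_z (p z.1 * q z.2) = (\int[mu]_x p x) * \int[mu]_y q y.
Proof.
move=> np nq; rewrite (nice2_Rfubini1 (nice_prod np nq))/=.
under eq_Rintegral do rewrite nice_RintegralZ// mulrC.
by rewrite nice_RintegralZ// mulrC.
Qed.

(** Integrate in t first and use translation invariance. For q = |f|^2 this evaluates the integral
    over t of the squared norm of f(x) conj f(x + t). *)
Lemma autocorrelation (q : T1 -> R) (N : R) : nice mu q -> (forall x, q x != 0 -> `|x| <= N) ->
  nice mu (fun t => \int[mu]_x (q x * q (x + t))) /\
  \int[mu]_t \int[mu]_x (q x * q (x + t)) = (\int[mu]_x q x) ^+ 2.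
Proof.
move=> nq q0.
have [M qM] := nice_bounded nq; have [mq _] := nq.
have n2 : nice2 mu mu (fun z : T2 => q z.2 * q (z.2 + z.1)).
  apply: (@box_nice2 _ _ (M * M) (N + N)) => [|z|t x /=].
  - apply: measurable_funM; first exact: (measurableT_comp mq measurable_snd).
    apply: (measurableT_comp mq); apply: (@measurable_funD _ _ _ _ snd fst).
      exact: measurable_snd.
    exact: measurable_fst.
  - exact: normM_le.
  - rewrite mulf_eq0 negb_or => /andP[/q0 h1 /q0 h2].
    have N0 := le_trans (normr_ge0 _) h1; split; last by lra.
    rewrite (_ : t = (x + t) - x); last by ring.
    by apply: le_trans (ler_normB _ _) _; lra.
split; first exact: (nice2_F n2).
have e1 := nice2_Rfubini1 n2; have e2 := nice2_Rfubini2 n2; rewrite /= in e1 e2.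
rewrite -e1 e2 expr2 -nice_RintegralZ//; apply: eq_Rintegral => x _.
have ns : nice mu (fun t => q (x + t)).
  by under eq_fun do rewrite addrC; exact: nice_shift.
apply: etrans (nice_RintegralZ (q x) ns) _; rewrite mulrC; congr (_ * _).
by under eq_Rintegral do rewrite addrC; rewrite nice_Rintegral_shift.
Qed.

(** 2 |p(x) p(x + c)| <= p(x)^2 + p(x + c)^2, and the two squares have the same integral. *)
Lemma Rintegral_norm_shift_le (p : T1 -> R) (c : R) : nice mu p ->
  \int[mu]_x (`|p x| * `|p (x + c)|) <= \int[mu]_x (p x ^+ 2).
Proof.
move=> np; have ns := nice_shift c np.
have n2 : nice mu (fun x => p x ^+ 2) by exact: niceM.
have ns2 := nice_shift c n2.
have -> : \int[mu]_x (p x ^+ 2) = \int[mu]_x (2^-1 * (p x ^+ 2 + p (x + c) ^+ 2)).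
  rewrite nice_RintegralZ; last exact: niceD.
  by rewrite nice_RintegralD// (nice_Rintegral_shift c n2); field.
apply: nice_le_Rintegral.
- by apply: niceM; exact: nice_norm.
- by apply: niceZ; exact: niceD.
move=> x; rewrite -(real_normK (num_real (p x))) -(real_normK (num_real (p (x + c)))).
have := sqr_ge0 (`|p x| - `|p (x + c)|); move: (`|p x|) (`|p (x + c)|) => u v.
by rewrite sqrrB; lra.
Qed.

End ComplexTTstar.

(** * The trilinear form for bounded functions *)

Section NiceRe.
Variable R : realType.
Notation mu := (@lebesgue_measure R).
Notation mu2 := (mu \x mu)%E.
Notation T1 := (measurableTypeR R).
Notation T2 := (T1 * T1)%type.

Lemma nice2_ReM (k l : T2 -> R[i]) (M N : R) : cmeas k -> cmeas l ->
  (forall p, cabs (k p) <= M) -> (forall p, cabs (l p) <= M) ->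
  (forall x y, k (x, y) != 0 -> l (x, y) != 0 -> `|x| <= N /\ `|y| <= N) ->
  nice2 mu mu (fun p => complex.Re (k p * l p)).
Proof.
move=> mk ml kM lM k0; apply: (@box_nice2 _ _ (M * M) N).
- by have [] := cmeasM mk ml.
- move=> p; apply: le_trans (normr_Re_le _) _; rewrite cabsM.
  by apply: ler_pM => //; exact: cabs_ge0.
- move=> x y; have [->|h1] := eqVneq (k (x, y)) 0; first by rewrite mul0r eqxx.
  have [->|h2] := eqVneq (l (x, y)) 0; first by rewrite mulr0 eqxx.
  by move=> _; exact: k0.
Qed.

Lemma measurable_fun_map2 (f g : T2 -> T1) : measurable_fun setT f -> measurable_fun setT g ->
  measurable_fun setT (fun p => (f p, g p)).
Proof. by move=> mf mg; apply/measurable_fun_pairP. Qed.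

Lemma nice_cabs (f : T1 -> R[i]) (M N : R) : cmeas f -> (forall x, cabs (f x) <= M) ->
  (forall x, f x != 0 -> `|x| <= N) -> nice mu (fun x => cabs (f x)).
Proof.
move=> mf fM f0; apply: (@box_nice _ _ M N) => [|x|x].
- exact: measurable_cabs.
- by rewrite ger0_norm ?cabs_ge0.
- by move=> h; apply: f0; apply: contra_neq h => ->; rewrite cabsE/= expr0n/= addr0 sqrtr0.
Qed.

End NiceRe.

Section Bounded.
Variable R : realType.
Local Opaque pdx pdy.
Notation mu := (@lebesgue_measure R).
Notation mu2 := (mu \x mu)%E.
Notation T1 := (measurableTypeR R).
Notation T2 := (T1 * T1)%type.

Variables (C0 d2 m : R) (I J : set R) (a : R * R -> R[i]) (S : R * R -> R).
Hypotheses (hC0 : 1 <= C0) (d20 : 0 < d2) (m0 : 0 < m)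
  (hJ : forall u v, J u -> J v -> `|u - v| <= d2)
  (sa : csmooth2 a) (suppa : supp a `<=` I `*` J)
  (a0 : forall p, cabs (a p) <= C0)
  (a1 : forall p, cabs (cpdy a p) <= C0 / d2)
  (a2 : forall p, cabs (cpdy (cpdy a) p) <= C0 / d2 ^+ 2)
  (sS : smooth2 S)
  (hP : forall p, Conv (supp a) p ->
     [/\ C0^-1 * m <= `|rotational S p|, `|rotational (pdy S) p| <= C0 * m / d2
       & `|rotational (pdy (pdy S)) p| <= C0 * m / d2 ^+ 2]).

Variables (lam : R) (f1 f2 f3 : T1 -> R[i]) (M N : R).
Hypotheses (lam0 : lam != 0) (CM : C0 <= M)
  (mf1 : cmeas f1) (mf2 : cmeas f2) (mf3 : cmeas f3)
  (f1M : forall x, cabs (f1 x) <= M) (f2M : forall x, cabs (f2 x) <= M)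
  (f3M : forall x, cabs (f3 x) <= M)
  (f1N : forall x, f1 x != 0 -> `|x| <= N) (f2N : forall x, f2 x != 0 -> `|x| <= N)
  (f3N : forall x, f3 x != 0 -> `|x| <= N)
  (aN : forall p, a p != 0 -> `|p.1| <= N /\ `|p.2| <= N).

Let M1 : 1 <= M. Proof. exact: le_trans CM. Qed.
Let M0 : 0 <= M. Proof. exact: le_trans M1. Qed.
Let N1 := \int[mu]_x cabs (f1 x) ^+ 2.
Let N2 := \int[mu]_x cabs (f2 x) ^+ 2.
Let N3 := \int[mu]_x cabs (f3 x) ^+ 2.

Let ma : @cmeas R _ T2 a.
Proof. by case: sa => sr si; split; apply: continuous_measurable2; exact: smooth2_continuous. Qed.

Let H (p : T2) := expi (lam * S p) * f1 p.1 * f2 p.2 * a p.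

Let mH : cmeas H.
Proof.
apply: cmeasM => //; apply: cmeasM; last exact: (cmeas_comp mf2 measurable_snd).
apply: cmeasM; last exact: (cmeas_comp mf1 measurable_fst).
apply: cmeas_expi; apply: measurable_funM => //.
by apply: continuous_measurable2; exact: smooth2_continuous.
Qed.

Let cabsH p : cabs (H p) <= C0 * (cabs (f1 p.1) * cabs (f2 p.2)).
Proof.
rewrite /H !cabsM cabs_expi mul1r mulrC ler_wpM2r// mulr_ge0 ?cabs_ge0//.
Qed.

Let HM p : cabs (H p) <= M * (M * M).
Proof.
apply: le_trans (cabsH p) _; apply: ler_pM => //; rewrite ?mulr_ge0 ?cabs_ge0//.
  exact: le_trans hC0.
by apply: ler_pM => //; exact: cabs_ge0.
Qed.

Let HN p : H p != 0 -> `|p.1| <= N /\ `|p.2| <= N.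
Proof.
rewrite /H !mulf_eq0 !negb_or => /andP[/andP[/andP[_ h1] h2] _].
by split; [exact: f1N|exact: f2N].
Qed.

(** [cTTstar] takes one bound for both functions; as M >= 1, the bound of H also serves for f3. *)
Let MM : M <= M * (M * M).
Proof. by rewrite ler_peMr// mulr_ege1. Qed.

Let N0 (x : R) : `|x| <= N -> 0 <= N.
Proof. exact: le_trans. Qed.

Let J1 t := \int[mu2]_p complex.Re (H p * conjc (H (p.1 - t, p.2 + t))).

Let mshift t : measurable_fun setT (fun p : T2 => (p.1 - t, p.2 + t) : T2).
Proof.
apply: measurable_fun_map2.
  exact: (@measurable_funD _ _ _ _ fst (cst (- t))).
exact: (@measurable_funD _ _ _ _ snd (cst t)).
Qed.

(** In the coordinates (x + y, y), f3 depends on the first one only, and shifting the second by t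
    moves (x, y) to (x - t, y + t). The shear carries the result back to the original
    coordinates. *)
Let first_TT : nice mu J1 /\
  (\int[mu2]_p complex.Re (H p * f3 (p.1 + p.2))) ^+ 2 <= N3 * \int[mu]_t J1 t.
Proof.
pose K (p : T2) := H (p.1 - p.2, p.2).
have mK : cmeas K.
  apply: (cmeas_comp mH); apply: measurable_fun_map2; last exact: measurable_snd.
  by apply: measurable_funB; [exact: measurable_fst|exact: measurable_snd].
have KN (x y : R) : K (x, y) != 0 -> `|x| <= N + N /\ `|y| <= N + N.
  move=> /HN[/= h1 h2]; have n0 := N0 h2; split; last by lra.
  rewrite (_ : x = x - y + y); last by ring.
  by apply: le_trans (ler_normD _ _) _; lra.
have JE t : \int[mu2]_p complex.Re (K p * conjc (K (p.1, p.2 + t))) = J1 t.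
  have mK' : cmeas (fun p : T2 => conjc (K (p.1, p.2 + t))).
    apply/cmeas_conjc/(cmeas_comp mK); apply: measurable_fun_map2; first exact: measurable_fst.
    exact: (@measurable_funD _ _ _ _ snd (cst t)).
  rewrite -(@Rintegral_shear _ (fun p => complex.Re (K p * conjc (K (p.1, p.2 + t)))) 1).
  - apply: eq_Rintegral => -[x y] _ /=; rewrite /K/= mul1r.
    by congr (complex.Re (H (_, _) * conjc (H (_, _)))); ring.
  - apply: (nice2_ReM (N := N + N) mK mK' (fun p => HM _)) => [p|x y h _].
      by rewrite cabs_conjc; exact: HM.
    exact: KN.
  - rewrite (_ : (fun p => _) = (fun p : T2 => complex.Re (H p * conjc (H (p.1 - t, p.2 + t))))).
      apply: (nice2_ReM (N := N) mH _ HM) => [|p|x y /HN//].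
        exact: (cmeas_conjc (cmeas_comp mH (mshift t))).
      by rewrite cabs_conjc; exact: HM.
    apply/funext => -[x y] /=; rewrite /K/= mul1r.
    by congr (complex.Re (H (_, _) * conjc (H (_, _)))); ring.
apply: (@cTTstar R f3 K _ (N + N) mf3 mK (fun x => le_trans (f3M x) MM) (fun p => HM _)
  (fun x h => le_trans (f3N h) (ler_wpDl (N0 (f3N h)) (lexx _))) KN) => [t|]; first by rewrite JE.
rewrite -(@Rintegral_shear _ (fun p => complex.Re (f3 p.1 * K p)) 1).
- apply: eq_Rintegral => -[x y] _ /=; rewrite /K/= mul1r mulrC.
  by congr (complex.Re (_ * H (_, _))); ring.
- apply: (nice2_ReM (N := N + N) (cmeas_comp mf3 measurable_fst) mK (fun p => le_trans (f3M _) MM) (fun p => HM _)).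
  by move=> x y _; exact: KN.
- rewrite (_ : (fun p => _) = (fun p : T2 => complex.Re (f3 (p.1 + p.2) * H p))).
    apply: (nice2_ReM (N := N) _ mH (fun p => le_trans (f3M _) MM) HM) => [|x y _ /HN//].
    apply: (cmeas_comp mf3).
    by apply: measurable_funD; [exact: measurable_fst|exact: measurable_snd].
  by apply/funext => -[x y] /=; rewrite /K/= mul1r addrK.
Qed.

Section FixedShift.
Variable t : R.
Hypothesis t0 : t != 0.

Let F x := f1 x * conjc (f1 (x - t)).
Let G y := f2 y * conjc (f2 (y + t)).
(** The pair is read as (y, x) and F is absorbed into the kernel: Cauchy-Schwarz then removes G(y),
    the shift falls on x, and the inner integral in y is the oscillatory one. *)
Let Kt (p : T2) := F p.2 * expi (lam * (S (p.2, p.1) - S (p.2 - t, p.1 + t)))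
  * (a (p.2, p.1) * conjc (a (p.2 - t, p.1 + t))).
(** Chosen so that d2 nu = k |s| when [kernel_estimate] is used at x' = x + s. *)
Let k := d2 * `|lam * t| * (m / C0).

Let k0 : 0 < k.
Proof.
have C0p : 0 < C0 by apply: lt_le_trans hC0.
by rewrite /k mulr_gt0 ?divr_gt0// mulr_gt0// normr_gt0 mulf_neq0.
Qed.

Let mF : cmeas F.
Proof. exact: (cmeasM mf1 (cmeas_conjc (cmeas_comp mf1 (measurable_addr_const (- t))))). Qed.

Let mG : cmeas G.
Proof. exact: (cmeasM mf2 (cmeas_conjc (cmeas_comp mf2 (measurable_addr_const t)))). Qed.

Let mKt : cmeas Kt.
Proof.
have ms := @measurable_fun_swap R.
have mss := measurableT_comp (mshift t) ms.
apply: cmeasM; last exact: (cmeasM (cmeas_comp ma ms) (cmeas_conjc (cmeas_comp ma mss))).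
apply: cmeasM; first exact: (cmeas_comp mF measurable_snd).
apply: cmeas_expi; apply: measurable_funM => //.
have mS : @measurable_fun _ _ T2 R setT S.
  by apply: continuous_measurable2; exact: smooth2_continuous.
by apply: measurable_funB; [exact: (measurableT_comp mS ms)|exact: (measurableT_comp mS mss)].
Qed.

Let FM x : cabs (F x) <= M * M.
Proof. by rewrite cabsM cabs_conjc; apply: ler_pM => //; exact: cabs_ge0. Qed.

Let KtM p : cabs (Kt p) <= M * M * (M * M).
Proof.
rewrite /Kt 2!cabsM cabs_expi mulr1 (cabsM (a _)) cabs_conjc.
have aM q : cabs (a q) <= M := le_trans (a0 q) CM.
apply: ler_pM; [exact: cabs_ge0|by rewrite mulr_ge0 ?cabs_ge0|exact: FM|].
by apply: ler_pM => //; exact: cabs_ge0.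
Qed.

Let GM x : cabs (G x) <= M * M * (M * M).
Proof.
rewrite cabsM cabs_conjc; apply: le_trans (_ : M * M <= _).
  by apply: ler_pM => //; exact: cabs_ge0.
by rewrite ler_peMr ?mulr_ge0// mulr_ege1.
Qed.

Let FN x : F x != 0 -> `|x| <= N.
Proof. by rewrite mulf_eq0 negb_or => /andP[/f1N]. Qed.

Let GN x : G x != 0 -> `|x| <= N.
Proof. by rewrite mulf_eq0 negb_or => /andP[/f2N]. Qed.

Let KtF p : Kt p != 0 -> F p.2 != 0.
Proof. by rewrite /Kt -mulrA mulf_eq0 negb_or => /andP[]. Qed.

Let KtN x y : Kt (x, y) != 0 -> `|x| <= N /\ `|y| <= N.
Proof.
rewrite /Kt !mulf_eq0 !negb_or => /andP[/andP[_ _] /andP[/aN]].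
by move=> [? ?] _; split.
Qed.

Let P := \int[mu]_x cabs (F x) ^+ 2.
Let Q := \int[mu]_y cabs (G y) ^+ 2.

Let JE : J1 t = \int[mu2]_p complex.Re (G p.1 * Kt p).
Proof.
have n1 : nice2 mu mu (fun p : T2 => complex.Re (G p.1 * Kt p)).
  by apply: (nice2_ReM (N := N) (cmeas_comp mG measurable_fst) mKt (fun p => GM _) KtM) => x y _; exact: KtN.
rewrite -(Rintegral_swap n1); apply: eq_Rintegral => -[x y] _ /=.
rewrite /H /Kt /G /F/= !conjcM conjc_expi mulrBr expiD.
by congr complex.Re; ring.
Qed.

Let B := N + N + 1.

Let kernel_bound (x s : R) : `|\int[mu]_y complex.Re (Kt (y, x) * conjc (Kt (y, x + s)))|
  <= (Kcst C0 * d2 / (1 + (k * s) ^+ 2)) * (cabs (F x) * cabs (F (x + s))).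
Proof.
have := kernel_estimate hC0 d20 m0 hJ sa suppa a0 a1 a2 sS hP lam t x (x + s) (F x * conjc (F (x + s))).
rewrite cabsM cabs_conjc [leRHS]mulrC.
have -> : (d2 * (`|lam * t * (x - (x + s))| * (m / C0))) ^+ 2 = (k * s) ^+ 2.
  rewrite (_ : x - (x + s) = - s); last by ring.
  rewrite (_ : d2 * _ = k * `|s|); last by rewrite normrM normrN /k; ring.
  by rewrite !(exprMn _ k) real_normK ?num_real.
congr (`|_| <= _); apply: eq_Rintegral => y _; rewrite /Kt/= !conjcM conjc_expi !conjcK.
rewrite /diff4 mulrBr [in expi (_ - _)]expiD -mulrN.
congr complex.Re; ring.
Qed.

Let mKts s : cmeas (fun p : T2 => conjc (Kt (p.1, p.2 + s))).
Proof.
apply/cmeas_conjc/(cmeas_comp mKt); apply: measurable_fun_map2; first exact: measurable_fst.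
exact: (@measurable_funD _ _ _ _ snd (cst s)).
Qed.

Let J2 s := \int[mu2]_p complex.Re (Kt p * conjc (Kt (p.1, p.2 + s))).

Let nP : nice mu (fun x => cabs (F x)) := nice_cabs mF FM FN.

(** After the kernel bound, the integral in x is the correlation of |F| with its translate by s,
    hence at most P. *)
Let J2_bound s : J2 s <= P * (Kcst C0 * d2) / (1 + (k * s) ^+ 2).
Proof.
have n2 : nice2 mu mu (fun p : T2 => complex.Re (Kt p * conjc (Kt (p.1, p.2 + s)))).
  apply: (nice2_ReM (N := N) mKt (mKts s) KtM) => [p|x y h _]; last exact: KtN.
  by rewrite cabs_conjc.
have nG := nice2_F (nice2_swap n2); rewrite /= in nG.
rewrite /J2 (nice2_Rfubini2 n2).
apply: le_trans (ler_norm _) _; apply: le_trans (nice_le_normr nG) _.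
set D := Kcst C0 * d2 / (1 + (k * s) ^+ 2).
have D0 : 0 <= D.
  rewrite /D divr_ge0//; first by rewrite mulr_ge0 ?ltW// Kcst_gt0.
  by rewrite addr_ge0 ?sqr_ge0.
have nFF : nice mu (fun x => `|cabs (F x)| * `|cabs (F (x + s))|).
  by apply: niceM; apply: nice_norm => //; exact: (nice_shift s nP).
apply: (@le_trans _ _ (\int[mu]_x (D * (`|cabs (F x)| * `|cabs (F (x + s))|)))).
  apply: nice_le_Rintegral; [exact: nice_norm|exact: niceZ|move=> x].
  by rewrite !(ger0_norm (cabs_ge0 _)); exact: kernel_bound.
rewrite nice_RintegralZ// (_ : P * _ / _ = D * P); last by rewrite /D; ring.
by apply: ler_wpM2l => //; exact: (Rintegral_norm_shift_le s nP).
Qed.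

Let J2_support s : B < `|s| -> J2 s = 0.
Proof.
move=> Bs; rewrite /J2.
transitivity (\int[mu2]_p (0 : R)); last by rewrite Rintegral_cst// mul0r.
apply: eq_Rintegral => -[x y] _ /=.
have [->|h1] := eqVneq (Kt (x, y)) 0; first by rewrite mul0r.
have [->|h2] := eqVneq (Kt (x, y + s)) 0; first by rewrite rmorph0 mulr0.
have [_ hy] := KtN h1; have [_ hys] := KtN h2.
suff : `|s| <= N + N by move: Bs; rewrite /B; lra.
rewrite (_ : s = (y + s) - y); last by ring.
by apply: le_trans (ler_normB _ _) _; lra.
Qed.

Let second_TT : J1 t ^+ 2 <= Q * (P * (Kcst C0 * d2) * pi / k).
Proof.
have [nJ2 le] := @cTTstar R G Kt _ N mG mKt GM KtM GN KtN J2 (J1 t) (fun s => erefl) JE.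
apply: le_trans le _; apply: ler_wpM2l.
  by apply: Rintegral_ge0 => x _; rewrite sqr_ge0.
have P0 : 0 <= P by apply: Rintegral_ge0 => x _; rewrite sqr_ge0.
have K0 := Kcst_gt0 hC0.
(* A negative N leaves no support at all; otherwise [-B, B] is a proper interval outside which J2
   vanishes. *)
have [Nneg|Nge] := ltP N 0.
  rewrite (_ : \int[mu]_s _ = 0).
    by rewrite divr_ge0 ?(ltW k0)// mulr_ge0 ?pi_ge0// mulr_ge0// mulr_ge0// ltW.
  transitivity (\int[mu]_s (0 : R)); last by rewrite Rintegral_cst// mul0r.
  apply: eq_Rintegral => s _; rewrite /J2.
  transitivity (\int[mu2]_p (0 : R)); last by rewrite Rintegral_cst// mul0r.
  apply: eq_Rintegral => -[x y] _ /=.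
  have [->|/KtN[/N0]] := eqVneq (Kt (x, y)) 0; first by rewrite mul0r.
  by rewrite leNgt Nneg.
have B0 : 0 < B by rewrite /B; lra.
apply: le_trans (Rintegral_atan_le _ k0 B0); last by rewrite mulr_ge0// mulr_ge0 ?ltW.
rewrite [leLHS](_ : _ = \int[mu]_(s in `[- B, B]) J2 s); last first.
  rewrite [RHS]Rintegral_mkcond; apply: eq_Rintegral => s _.
  rewrite patchE; case: ifPn => //; rewrite notin_setE/= in_itv/= -ler_norml => /negP.
  by rewrite -ltNge => /J2_support.
apply: le_Rintegral => //.
- by apply: integrableS (nice_integrable nJ2).
- apply: continuous_compact_integrable; first exact: segment_compact.
  apply: continuous_subspaceT => x; apply: cvgM; first exact: cvg_cst.
  apply: cvgV; first by rewrite gt_eqF//; have := sqr_ge0 (k * x); lra.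
  apply: cvgD; first exact: cvg_cst.
  apply: (@continuous_comp _ _ _ (fun x => k * x) (fun x => x ^+ 2)); last exact: exprn_continuous.
  exact: mulrl_continuous.
Qed.

(** The d2 of the kernel bound cancels against the one in k, leaving C0 / (|lam t| m). *)
Lemma shifted_form_le : J1 t ^+ 2 <= (pi * Kcst C0 * C0) * (P * Q) / (`|lam * m| * `|t|).
Proof.
apply: le_trans second_TT _.
have P0 : 0 <= P by apply: Rintegral_ge0 => x _; rewrite sqr_ge0.
have Q0 : 0 <= Q by apply: Rintegral_ge0 => x _; rewrite sqr_ge0.
have K0 := Kcst_gt0 hC0; have C0p : 0 < C0 by apply: lt_le_trans hC0.
have lt0 : 0 < `|lam * t| by rewrite normr_gt0 mulf_neq0.
rewrite (_ : Q * _ = (pi * Kcst C0 * C0) * (P * Q) / (`|lam * m| * `|t|))//.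
rewrite /k !normrM (gtr0_norm m0); field.
by rewrite !gt_eqF ?normr_gt0.
Qed.

End FixedShift.
Let q1 x := cabs (f1 x) ^+ 2.
Let q2 x := cabs (f2 x) ^+ 2.

Let nc1 : nice mu (fun x => cabs (f1 x)) := nice_cabs mf1 f1M f1N.
Let nc2 : nice mu (fun x => cabs (f2 x)) := nice_cabs mf2 f2M f2N.
Let nq1 : nice mu q1 := niceM nc1 nc1.
Let nq2 : nice mu q2 := niceM nc2 nc2.

Let A1 t := \int[mu]_x (q1 x * q1 (x + t)).
Let A2 t := \int[mu]_x (q2 x * q2 (x + t)).

Let A1_ge0 t : 0 <= A1 t.
Proof. by apply: Rintegral_ge0 => x _; rewrite mulr_ge0 ?sqr_ge0. Qed.

Let A2_ge0 t : 0 <= A2 t.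
Proof. by apply: Rintegral_ge0 => x _; rewrite mulr_ge0 ?sqr_ge0. Qed.

Let cabs0 (z : R[i]) : cabs z != 0 -> z != 0.
Proof. by apply: contra_neq => ->; rewrite cabsE/= expr0n/= addr0 sqrtr0. Qed.

Let sqr_cabs_support (f : T1 -> R[i]) x : (forall x, f x != 0 -> `|x| <= N) ->
  cabs (f x) ^+ 2 != 0 -> `|x| <= N.
Proof. by move=> f0; rewrite sqrf_eq0 => /cabs0 /f0. Qed.

Let C1 := pi * Kcst C0 * C0.

Let C1_ge1 : 1 <= C1.
Proof.
have pi1 : 1 <= pi :> R by apply: le_trans (@pi_ge2 R); rewrite ler1n.
have K1 : 1 <= Kcst C0.
  by rewrite /Kcst mulr_ege1 ?exprn_ege1// mulr_ege1// ler1n.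
by rewrite /C1 mulr_ege1// mulr_ege1.
Qed.

Let J1_le t : t != 0 -> J1 t ^+ 2 <= C1 * (A1 t * A2 t) / (`|lam * m| * `|t|).
Proof.
move=> t0; apply: le_trans (shifted_form_le t0) _.
rewrite le_eqVlt; apply/orP; left; apply/eqP; congr (_ * (_ * _) / _).
  (* F carries the shift -t; translating by t gives the autocorrelation at t. *)
  pose h x := q1 x * q1 (x - t).
  transitivity (\int[mu]_x h x).
    by apply: eq_Rintegral => x _; rewrite cabsM cabs_conjc exprMn.
  rewrite -(@nice_Rintegral_shift _ h t); last exact: (niceM nq1 (nice_shift (- t) nq1)).
  by apply: eq_Rintegral => x _; rewrite /h addrK mulrC.
by apply: eq_Rintegral => x _; rewrite cabsM cabs_conjc exprMn.
Qed.

(** Without using the oscillation: |H| <= C0 |f1| |f2| makes the plane integral a product of two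
    correlations. *)
Let J1_trivial t : `|J1 t| <= C0 ^+ 2 * (N1 * N2).
Proof.
have C0p : 0 <= C0 by apply: le_trans hC0.
pose p x := `|cabs (f1 x)| * `|cabs (f1 (x - t))|.
pose q x := `|cabs (f2 x)| * `|cabs (f2 (x + t))|.
have np : nice mu p by apply: niceM; apply: nice_norm => //; exact: (nice_shift (- t) nc1).
have nq : nice mu q by apply: niceM; apply: nice_norm => //; exact: (nice_shift t nc2).
have nH : nice2 mu mu (fun p : T2 => complex.Re (H p * conjc (H (p.1 - t, p.2 + t)))).
  apply: (nice2_ReM (N := N) mH _ HM) => [|z|x y /HN//].
    exact: (cmeas_conjc (cmeas_comp mH (mshift t))).
  by rewrite cabs_conjc; exact: HM.
apply: le_trans (nice_le_normr (nice2_nice nH)) _.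
apply: (@le_trans _ _ (\int[mu2]_z (C0 ^+ 2 * (p z.1 * q z.2)))).
  apply: nice_le_Rintegral.
  - exact: nice_norm (nice2_nice nH).
  - exact: niceZ (nice2_nice (nice_prod np nq)).
  move=> z; apply: le_trans (normr_Re_le _) _; rewrite cabsM cabs_conjc.
  apply: le_trans (ler_pM (cabs_ge0 _) (cabs_ge0 _) (cabsH _) (cabsH _)) _ => /=.
  by rewrite /p /q !(ger0_norm (cabs_ge0 _)) le_eqVlt; apply/orP; left; apply/eqP; ring.
rewrite (nice_RintegralZ _ (nice2_nice (nice_prod np nq))) (Rintegral_prod np nq).
apply: ler_wpM2l; first exact: sqr_ge0.
apply: ler_pM.
- by apply: Rintegral_ge0 => x _; rewrite mulr_ge0.
- by apply: Rintegral_ge0 => x _; rewrite mulr_ge0.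
- exact: (Rintegral_norm_shift_le (- t) nc1).
- exact: (Rintegral_norm_shift_le t nc2).
Qed.

Variable r : R.
Hypotheses (r0 : 0 < r) (r6 : r ^+ 6 = `|lam * m|^-1).

Let N1_ge0 : 0 <= N1. Proof. by apply: Rintegral_ge0 => x _; rewrite sqr_ge0. Qed.
Let N2_ge0 : 0 <= N2. Proof. by apply: Rintegral_ge0 => x _; rewrite sqr_ge0. Qed.
Let N3_ge0 : 0 <= N3. Proof. by apply: Rintegral_ge0 => x _; rewrite sqr_ge0. Qed.

Let nJ1 : nice mu J1. Proof. by case: first_TT. Qed.

(** For |t| > r^2, [J1_le] with r^6 / |t| <= r^4 bounds |J1| by a multiple of r^2 times the
    geometric mean of A1 and A2. The weight s replaces this mean by a linear expression whose
    integral is known from [autocorrelation]. *)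
Let J1_pointwise s t : 0 < s -> `|J1 t| <= C0 ^+ 2 * (N1 * N2) * \1_(`[- r ^+ 2, r ^+ 2]%classic) t
   + C1 * r ^+ 2 / 2 * (s * A1 t + s^-1 * A2 t).
Proof.
move=> s0; have C1p : 0 < C1 by apply: lt_le_trans C1_ge1.
have r20 : 0 < r ^+ 2 by rewrite exprn_gt0.
have sA : 0 <= s * A1 t + s^-1 * A2 t.
  by apply: addr_ge0; apply: mulr_ge0; rewrite ?A1_ge0 ?A2_ge0 ?invr_ge0 ?(ltW s0).
have E0 : 0 <= C1 * r ^+ 2 / 2 * (s * A1 t + s^-1 * A2 t).
  by rewrite mulr_ge0// divr_ge0// mulr_ge0 ?ltW.
rewrite indicE; have [tr|tr] := leP (`|t|) (r ^+ 2).
  rewrite mem_set/=; last by rewrite in_itv/= -ler_norml.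
  by rewrite mulr1 ler_wpDr// J1_trivial.
rewrite memNset/=; last by rewrite in_itv/= -ler_norml leNgt tr.
rewrite mulr0 add0r -(@ler_pXn2r _ 2)// real_normK ?num_real//.
have tp : 0 < `|t| by apply: lt_trans tr.
apply: le_trans (J1_le _) _; first by rewrite -normr_gt0.
rewrite invfM mulrA -r6.
have AA : 0 <= A1 t * A2 t by exact: mulr_ge0.
apply: (@le_trans _ _ (C1 * (A1 t * A2 t) * r ^+ 4)).
  rewrite ler_pdivrMr// -(mulrA _ (r ^+ 4)); apply: ler_wpM2l; first by rewrite mulr_ge0// ltW.
  rewrite (_ : r ^+ 6 = r ^+ 4 * r ^+ 2); last by ring.
  by apply: ler_wpM2l; [rewrite exprn_ge0// ltW|exact: ltW].
(* As C1 >= 1, a second factor C1 makes the constant a perfect square. *)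
apply: (@le_trans _ _ (C1 * (C1 * (A1 t * A2 t) * r ^+ 4))).
  rewrite ler_peMl//; apply: mulr_ge0; last by rewrite exprn_ge0// ltW.
  by apply: mulr_ge0 => //; exact: ltW.
have -> : (C1 * r ^+ 2 / 2 * (s * A1 t + s^-1 * A2 t)) ^+ 2 =
   C1 * (C1 * (A1 t * A2 t) * r ^+ 4) + (C1 * r ^+ 2 / 2 * (s * A1 t - s^-1 * A2 t)) ^+ 2.
  by field; rewrite gt_eqF.
by rewrite lerDl sqr_ge0.
Qed.

Let int_J1_le s : 0 < s -> \int[mu]_t `|J1 t| <=
  2 * r ^+ 2 * (C0 ^+ 2 * (N1 * N2)) + C1 * r ^+ 2 / 2 * (s * N1 ^+ 2 + s^-1 * N2 ^+ 2).
Proof.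
move=> s0.
have [nA1 eA1] := autocorrelation nq1 (fun x => sqr_cabs_support f1N).
have [nA2 eA2] := autocorrelation nq2 (fun x => sqr_cabs_support f2N).
have n1 : nice mu (\1_(`[- r ^+ 2, r ^+ 2]%classic) : T1 -> R).
  apply: (@box_nice _ _ 1 (r ^+ 2)) => [|x|x].
  - exact: measurable_indic.
  - by rewrite indicE; case: (_ \in _); rewrite ?normr1 ?normr0.
  - rewrite indicE; have [|] := boolP (x \in _); last by rewrite eqxx.
    by rewrite inE/= in_itv/= -ler_norml.
have e1 : \int[mu]_x (\1_(`[- r ^+ 2, r ^+ 2]%classic) x : R) = 2 * r ^+ 2.
  rewrite /Rintegral integral_indic//= setIT lebesgue_measure_itv/= lte_fin.
  have r20 : 0 < r ^+ 2 by rewrite exprn_gt0.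
  by rewrite ifT/=; [ring|lra].
have nA : nice mu (fun t => s * A1 t + s^-1 * A2 t) by apply: niceD; exact: niceZ.
apply: (@le_trans _ _ (\int[mu]_t (C0 ^+ 2 * (N1 * N2) * \1_(`[- r ^+ 2, r ^+ 2]%classic) t
   + C1 * r ^+ 2 / 2 * (s * A1 t + s^-1 * A2 t)))).
  apply: nice_le_Rintegral; [exact: nice_norm|by apply: niceD; exact: niceZ|].
  by move=> t; exact: J1_pointwise.
rewrite (nice_RintegralD (niceZ _ n1) (niceZ _ nA)) (nice_RintegralZ _ n1) (nice_RintegralZ _ nA).
rewrite e1 (nice_RintegralD (niceZ _ nA1) (niceZ _ nA2)) (nice_RintegralZ _ nA1) (nice_RintegralZ _ nA2).
by rewrite eA1 eA2 [_ * (2 * _)]mulrC.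
Qed.

Lemma bounded_form_le : (\int[mu2]_p complex.Re (H p * f3 (p.1 + p.2))) ^+ 2 <=
  (2 * C0 ^+ 2 + C1) * r ^+ 2 * (N1 * N2 * N3).
Proof.
have [_ le1] := first_TT; apply: le_trans le1 _.
rewrite [leRHS](_ : _ = N3 * ((2 * C0 ^+ 2 + C1) * r ^+ 2 * (N1 * N2))); last by ring.
apply: ler_wpM2l => //.
apply: le_trans (ler_norm _) _; apply: le_trans (nice_le_normr nJ1) _.
(* The weight chosen below needs both norms positive; otherwise J1 vanishes by the trivial bound. *)
have [N120|N12ne] := eqVneq (N1 * N2) 0.
  rewrite N120 mulr0 le_eqVlt; apply/orP; left; apply/eqP.
  transitivity (\int[mu]_s (0 : R)); last by rewrite Rintegral_cst// mul0r.
  apply: eq_Rintegral => t _; apply/eqP; rewrite eq_le normr_ge0 andbT.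
  by have := J1_trivial t; rewrite N120 mulr0.
move: N12ne; rewrite mulf_eq0 negb_or => /andP[N1ne N2ne].
have N1p : 0 < N1 by rewrite lt_def N1ne.
have N2p : 0 < N2 by rewrite lt_def N2ne.
(* s = N2 / N1 turns s N1^2 + N2^2 / s into 2 N1 N2. *)
apply: le_trans (int_J1_le (divr_gt0 N2p N1p)) _.
rewrite le_eqVlt; apply/orP; left; apply/eqP; field.
by rewrite N1ne N2ne.
Qed.

End Bounded.

(** * Square-integrable functions *)

Section Truncation.
Variable R : realType.
Notation mu := (@lebesgue_measure R).
Notation mu2 := (mu \x mu)%E.
Notation T1 := (measurableTypeR R).
Notation T2 := (T1 * T1)%type.
Implicit Type f : T1 -> R[i].

Definition square_integrable f :=
  cmeas f /\ (\int[mu]_x (cabs (f x) ^+ 2)%:E < +oo)%E.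

(** Cutting both the values and the argument at n supplies the bounds M = N = n of
    [bounded_form_le]. *)
Definition trunc_dom f (n : nat) : set T1 := [set x | cabs (f x) <= n%:R /\ `|x| <= n%:R].

Definition trunc f (n : nat) (x : T1) : R[i] := Complex (\1_(trunc_dom f n) x) 0 * f x.

Lemma measurable_trunc_dom f n : cmeas f -> measurable (trunc_dom f n).
Proof.
move=> mf; rewrite (_ : trunc_dom f n = ((fun x => cabs (f x)) @^-1` `]-oo, n%:R]) `&` `[- n%:R, n%:R]).
  apply: measurableI => //; rewrite -[X in measurable X]setTI.
  exact: (measurable_cabs mf).
by apply/seteqP; split => x /=; rewrite /trunc_dom/= !in_itv/= -ler_norml => -[? ?]; split.
Qed.

Lemma cmeas_trunc f n : cmeas f -> cmeas (trunc f n).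
Proof.
move=> mf; apply: cmeasM => //; split => /=; last exact: measurable_cst.
by apply: measurable_indic; exact: measurable_trunc_dom.
Qed.

Lemma truncE f n x : trunc f n x = if `[< trunc_dom f n x >] then f x else 0.
Proof.
rewrite /trunc indicE; case: asboolP => h.
  by rewrite mem_set// [X in X * _](_ : _ = 1)// mul1r.
by rewrite memNset// [X in X * _](_ : _ = 0)// mul0r.
Qed.

Lemma cabs_complex0 : cabs (0 : R[i]) = 0.
Proof. by rewrite cabsE/= expr0n/= addr0 sqrtr0. Qed.

Lemma cabs_trunc_le f n x : cabs (trunc f n x) <= cabs (f x).
Proof. by rewrite truncE; case: asboolP => // _; rewrite cabs_complex0 cabs_ge0. Qed.

Lemma cabs_trunc_bound f n x : cabs (trunc f n x) <= n%:R.
Proof. by rewrite truncE; case: asboolP => [[]//|_]; rewrite cabs_complex0. Qed.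

Lemma trunc_support f n x : trunc f n x != 0 -> `|x| <= n%:R.
Proof. by rewrite truncE; case: asboolP => [[]//|_]; rewrite eqxx. Qed.

(** At each point the truncation is eventually exact, so the integrands converge as eventually
    constant sequences. *)
Lemma trunc_near f x : \forall n \near \oo, trunc f n x = f x.
Proof.
have : 0 <= Num.max (cabs (f x)) `|x| by rewrite le_max cabs_ge0.
move=> /archi_boundP; set n0 := Num.bound _ => h.
exists n0 => // n /= n0n; rewrite truncE asboolT//.
have le : Num.max (cabs (f x)) `|x| <= n%:R.
  by apply: le_trans (ltW h) _; rewrite ler_nat.
by move: le; rewrite ge_max => /andP[].
Qed.

Lemma square_integrable_integrable f : square_integrable f ->
  mu.-integrable setT (EFin \o (fun x => cabs (f x) ^+ 2)).
Proof.
move=> [mf foo]; apply/integrableP; split.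
  exact/measurable_EFinP/measurable_cabs_sqr.
by under eq_integral do rewrite /= ger0_norm ?sqr_ge0//.
Qed.

Lemma trunc_norm_le f n : square_integrable f ->
  \int[mu]_x cabs (trunc f n x) ^+ 2 <= \int[mu]_x cabs (f x) ^+ 2.
Proof.
move=> sf; have [mf _] := sf.
have nt := nice_cabs (cmeas_trunc n mf) (cabs_trunc_bound f n) (@trunc_support f n).
apply: le_Rintegral => //.
- exact: nice_integrable (niceM nt nt).
- exact: square_integrable_integrable.
- by move=> x _; rewrite ler_pXn2r ?nnegrE ?cabs_ge0// cabs_trunc_le.
Qed.

Lemma ge0_integral_translation (f : T1 -> R) (c : R) : measurable_fun setT f ->
  (forall x, 0 <= f x) ->
  (\int[mu]_x (f (x + c))%:E = \int[mu]_x (f x)%:E)%E.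
Proof.
move=> mf f0; have mc := measurable_addr_const c.
pose F : {mfun measurableTypeR R >-> measurableTypeR R} :=
  MeasurableFun.Pack (MeasurableFun.Class (isMeasurableFun.Build _ _ _ _ _ mc)).
symmetry; rewrite (eq_measure_integral (pushforward mu F)); last first.
  by move=> A mA _; rewrite [RHS](lebesgue_translation c mA).
rewrite ge0_integral_pushforward//; first exact/measurable_EFinP.
by move=> x _; rewrite lee_fin.
Qed.

Lemma ge0_prod_lty (p q : T1 -> R) :
  mu.-integrable setT (EFin \o p) -> mu.-integrable setT (EFin \o q) ->
  (forall x, 0 <= p x) -> (forall x, 0 <= q x) ->
  (\int[mu]_x ((\int[mu]_y (q y)%:E) * (p x)%:E) < +oo)%E.
Proof.
move=> ip iq p0 q0.
have mp : measurable_fun setT (EFin \o p) := measurable_int _ ip.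
have fp := integrable_fin_num measurableT ip; have fq := integrable_fin_num measurableT iq.
rewrite ge0_integralZl//; last 2 first.
- by move=> x _; rewrite lee_fin.
- by apply: integral_ge0 => y _; rewrite lee_fin.
by rewrite -(fineK fp) -(fineK fq) -EFinM ltry.
Qed.

Lemma integrable_prod (p q : T1 -> R) :
  mu.-integrable setT (EFin \o p) -> mu.-integrable setT (EFin \o q) ->
  (forall x, 0 <= p x) -> (forall x, 0 <= q x) ->
  mu2.-integrable setT (EFin \o (fun z : T2 => p z.1 * q z.2)).
Proof.
move=> ip iq p0 q0.
have mp : measurable_fun setT p by apply/measurable_EFinP; exact: measurable_int ip.
have mq : measurable_fun setT q by apply/measurable_EFinP; exact: measurable_int iq.
have mpq : measurable_fun setT (EFin \o (fun z : T2 => p z.1 * q z.2)).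
  apply/measurable_EFinP; apply: measurable_funM; first exact: (measurableT_comp mp measurable_fst).
  exact: (measurableT_comp mq measurable_snd).
apply/(integrable12ltyP mu mu mpq).
have Eq x : (\int[mu]_y `|(p x * q y)%R%:E| = (\int[mu]_y (q y)%:E) * (p x)%:E)%E.
  rewrite muleC -ge0_integralZl_EFin//; last 2 first.
  - by move=> y _; rewrite lee_fin.
  - exact/measurable_EFinP.
  by apply: eq_integral => y _; rewrite /= ger0_norm ?mulr_ge0// EFinM.
rewrite (eq_integral _ _ (fun x _ => Eq x)) (ge0_prod_lty ip iq)//.
Qed.

(** q(x + y) by itself is in general not integrable over the plane; with x confined to [-B, B],
    translation invariance in y gives a finite integral. *)
Lemma integrable_diag (q : T1 -> R) (B : R) : mu.-integrable setT (EFin \o q) ->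
  (forall x, 0 <= q x) ->
  mu2.-integrable setT (EFin \o (fun z : T2 => \1_(`[- B, B]%classic) z.1 * q (z.1 + z.2))).
Proof.
move=> iq q0.
have mq : measurable_fun setT q by apply/measurable_EFinP; exact: measurable_int iq.
have mi : measurable_fun setT (\1_(`[- B, B]%classic) : T1 -> R) by exact: measurable_indic.
have i0 x : 0 <= (\1_(`[- B, B]%classic) : T1 -> R) x by rewrite indicE; case: (_ \in _).
have mpq : measurable_fun setT (EFin \o (fun z : T2 => \1_(`[- B, B]%classic) z.1 * q (z.1 + z.2))).
  apply/measurable_EFinP; apply: measurable_funM; first exact: (measurableT_comp mi measurable_fst).
  apply: (measurableT_comp mq).
  by apply: measurable_funD; [exact: measurable_fst|exact: measurable_snd].
apply/(integrable12ltyP mu mu mpq).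
have Eq x : (\int[mu]_y `|(\1_(`[- B, B]%classic) x * q (x + y))%R%:E|
    = (\int[mu]_y (q y)%:E) * (\1_(`[- B, B]%classic) x)%:E)%E.
  rewrite muleC -(ge0_integral_translation x mq q0) -ge0_integralZl_EFin//; last 2 first.
  - by move=> y _; rewrite lee_fin.
  - by apply/measurable_EFinP; apply: (measurableT_comp mq); exact: measurable_addr_const.
  by apply: eq_integral => y _; rewrite /= ger0_norm ?mulr_ge0// EFinM addrC.
have ii := integrable_indic_itv (- B) B true false.
apply: le_lt_trans (ge0_prod_lty ii iq i0 q0).
by rewrite le_eqVlt; apply/orP; left; apply/eqP; apply: eq_integral => x _; exact: Eq.
Qed.

End Truncation.

(** * Passage to the limit in the truncation *)

Section Form.
Variable R : realType.
Local Opaque pdx pdy.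
Notation mu := (@lebesgue_measure R).
Notation mu2 := (mu \x mu)%E.
Notation T1 := (measurableTypeR R).
Notation T2 := (T1 * T1)%type.

Variables (C0 d1 d2 m : R) (I J : set R) (a : R * R -> R[i]) (S : R * R -> R).
Hypotheses (hC0 : 1 <= C0) (d20 : 0 < d2) (m0 : 0 < m)
  (hI : forall u v, I u -> I v -> `|u - v| <= d1)
  (hJ : forall u v, J u -> J v -> `|u - v| <= d2)
  (sa : csmooth2 a) (suppa : supp a `<=` I `*` J)
  (a0 : forall p, cabs (a p) <= C0)
  (a1 : forall p, cabs (cpdy a p) <= C0 / d2)
  (a2 : forall p, cabs (cpdy (cpdy a) p) <= C0 / d2 ^+ 2)
  (sS : smooth2 S)
  (hP : forall p, Conv (supp a) p ->
     [/\ C0^-1 * m <= `|rotational S p|, `|rotational (pdy S) p| <= C0 * m / d2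
       & `|rotational (pdy (pdy S)) p| <= C0 * m / d2 ^+ 2]).
Variables (lam r : R).
Hypotheses (lam0 : lam != 0) (r0 : 0 < r) (r6 : r ^+ 6 = `|lam * m|^-1).

(** The bound depends on where the support lies; it serves the convergence of integrals and does not
    enter the constant. *)
Let a_bounded : exists B : R, forall p, a p != 0 -> `|p.1| <= B /\ `|p.2| <= B.
Proof.
have [[q aq]|noq] := pselect (exists q, a q != 0); last first.
  by exists 0 => p ap; exfalso; apply: noq; exists p.
have [/= Iq Jq] := suppa (supp_neq0 aq).
exists (`|q.1| + `|d1| + (`|q.2| + d2)) => p ap.
have [/= Ip Jp] := suppa (supp_neq0 ap).
have h1 := hI Ip Iq; have h2 := hJ Jp Jq.
have h3 := le_trans h1 (ler_norm d1).
have e1 : `|p.1| <= `|p.1 - q.1| + `|q.1| by rewrite -{1}(subrK q.1 p.1) ler_normD.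
have e2 : `|p.2| <= `|p.2 - q.2| + `|q.2| by rewrite -{1}(subrK q.2 p.2) ler_normD.
have n1 := normr_ge0 q.1; have n2 := normr_ge0 q.2; have n3 := normr_ge0 d1.
have d2p := d20.
by split; lra.
Qed.

(** The constant of [bounded_form_le], which concerns the square of the form. Being at least 1, it
    is at most its own square and so serves for the form itself without a root. *)
Definition form_cst := 2 * C0 ^+ 2 + pi * Kcst C0 * C0.

Lemma form_cst_ge1 : 1 <= form_cst.
Proof.
have : 1 <= C0 ^+ 2 by rewrite exprn_ege1.
have : 0 <= pi * Kcst C0 * C0.
  apply: mulr_ge0; last exact: le_trans hC0.
  by apply: mulr_ge0; [exact: pi_ge0|exact/ltW/Kcst_gt0].
by rewrite /form_cst; lra.
Qed.

Variables (f1 f2 f3 : T1 -> R[i]).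
Hypotheses (sf1 : square_integrable f1) (sf2 : square_integrable f2)
  (sf3 : square_integrable f3).

Let nrm (f : T1 -> R[i]) := Num.sqrt (\int[mu]_x cabs (f x) ^+ 2).

Let form (g1 g2 g3 : T1 -> R[i]) (p : T2) :=
  complex.Re (expi (lam * S p) * g1 p.1 * g2 p.2 * a p * g3 (p.1 + p.2)).

Let tform n := form (trunc f1 n) (trunc f2 n) (trunc f3 n).

Let X := form_cst * r * (nrm f1 * nrm f2 * nrm f3).

Let X_ge0 : 0 <= X.
Proof.
rewrite /X mulr_ge0 ?mulr_ge0 ?sqrtr_ge0 ?(ltW r0)//.
by apply: le_trans form_cst_ge1.
Qed.

Let tform_le : \forall n \near \oo, `|\int[mu2]_p tform n p| <= X.
Proof.
have [B aB] := a_bounded.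
(* [bounded_form_le] also asks n to dominate C0 and to bound the support of a. *)
have : 0 <= Num.max C0 `|B| by rewrite le_max normr_ge0 orbT.
move=> /archi_boundP; set n0 := Num.bound _ => h; exists n0 => // n /= n0n.
have : Num.max C0 `|B| <= n%:R by apply: le_trans (ltW h) _; rewrite ler_nat.
rewrite ge_max => /andP[Cn Bn].
have aN p : a p != 0 -> `|p.1| <= n%:R /\ `|p.2| <= n%:R.
  by move=> /aB[? ?]; split; apply: le_trans (le_trans (ler_norm B) Bn).
have mt (f : T1 -> R[i]) : square_integrable f -> cmeas (trunc f n) by move=> [mf _]; exact: cmeas_trunc.
have := bounded_form_le hC0 d20 m0 hJ sa suppa a0 a1 a2 sS hP lam0 Cn (mt _ sf1) (mt _ sf2) (mt _ sf3)
  (cabs_trunc_bound f1 n) (cabs_trunc_bound f2 n) (cabs_trunc_bound f3 n)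
  (@trunc_support _ f1 n) (@trunc_support _ f2 n) (@trunc_support _ f3 n) aN r0 r6.
move=> le; rewrite -(@ler_pXn2r _ 2) ?nnegrE// real_normK ?num_real//.
apply: le_trans le _.
have I0 (f : T1 -> R[i]) : 0 <= \int[mu]_x cabs (f x) ^+ 2.
  by apply: Rintegral_ge0 => x _; rewrite sqr_ge0.
rewrite /X !exprMn /nrm !sqr_sqrtr//.
have c1 := form_cst_ge1.
apply: ler_pM.
- by rewrite mulr_ge0 ?sqr_ge0// (le_trans _ c1).
- by rewrite !mulr_ge0.
- by apply: ler_wpM2r; rewrite ?sqr_ge0// expr2 ler_peMl// (le_trans _ c1).
- apply: ler_pM; [by rewrite mulr_ge0|by []| |exact: trunc_norm_le].
  by apply: ler_pM; rewrite ?I0//; exact: trunc_norm_le.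
Qed.

Let mform (g1 g2 g3 : T1 -> R[i]) : cmeas g1 -> cmeas g2 -> cmeas g3 ->
  measurable_fun setT (form g1 g2 g3).
Proof.
move=> m1 m2 m3.
have ma : @cmeas R _ T2 a.
  by case: sa => sr si; split; apply: continuous_measurable2; exact: smooth2_continuous.
suff [] : cmeas (fun p : T2 => expi (lam * S p) * g1 p.1 * g2 p.2 * a p * g3 (p.1 + p.2)) by [].
apply: cmeasM; last first.
  apply: (cmeas_comp m3).
  by apply: measurable_funD; [exact: measurable_fst|exact: measurable_snd].
apply: cmeasM => //; apply: cmeasM; last exact: (cmeas_comp m2 measurable_snd).
apply: cmeasM; last exact: (cmeas_comp m1 measurable_fst).
apply: cmeas_expi; apply: measurable_funM => //.
by apply: continuous_measurable2; exact: smooth2_continuous.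
Qed.

(** From u v w <= (u v)^2 + w^2 with u = |f1|, v = |f2|, w = |f3|, and |a| <= C0. The first term is
    integrable as a product; the second is cut to the x-range of the support of a. *)
Let dom_bound (B : R) (p : T2) := C0 * (cabs (f1 p.1) ^+ 2 * cabs (f2 p.2) ^+ 2) +
   C0 * (\1_(`[- B, B]%classic) p.1 * cabs (f3 (p.1 + p.2)) ^+ 2).

Let integrable_dom B : mu2.-integrable setT (EFin \o dom_bound B).
Proof.
have i1 := integrable_prod (square_integrable_integrable sf1) (square_integrable_integrable sf2)
  (fun x => sqr_ge0 _) (fun x => sqr_ge0 _).
have i2 := integrable_diag B (square_integrable_integrable sf3) (fun x => sqr_ge0 _).
exact: (integrableD measurableT (integrableZl measurableT C0 i1) (integrableZl measurableT C0 i2)).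
Qed.

Let form_le_dom B (g1 g2 g3 : T1 -> R[i]) p : (forall p, a p != 0 -> `|p.1| <= B) ->
  (forall x, cabs (g1 x) <= cabs (f1 x)) -> (forall x, cabs (g2 x) <= cabs (f2 x)) ->
  (forall x, cabs (g3 x) <= cabs (f3 x)) -> `|form g1 g2 g3 p| <= dom_bound B p.
Proof.
move=> aB h1 h2 h3; apply: le_trans (normr_Re_le _) _; rewrite !cabsM cabs_expi mul1r.
have C0p : 0 <= C0 by apply: le_trans hC0.
have [->|ap] := eqVneq (a p) 0.
  rewrite cabs_complex0 mulr0 mul0r.
  apply: addr_ge0; apply: mulr_ge0 => //; apply: mulr_ge0; rewrite ?sqr_ge0//.
rewrite /dom_bound indicE mem_set/=; last by rewrite in_itv/= -ler_norml aB.
rewrite mul1r -mulrDr mulrAC mulrC.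
apply: ler_pM => //; rewrite ?mulr_ge0 ?cabs_ge0//.
have q0 := @cabs_ge0 R.
apply: (@le_trans _ _ (cabs (f1 p.1) * cabs (f2 p.2) * cabs (f3 (p.1 + p.2)))).
  by rewrite !ler_pM ?mulr_ge0.
move: (cabs (f1 p.1)) (cabs (f2 p.2)) (cabs (f3 _)) => u v w.
rewrite -exprMn; have := sqr_ge0 (u * v - w); have := sqr_ge0 (u * v); have := sqr_ge0 w.
by rewrite sqrrB; lra.
Qed.

Lemma Re_form_le : `|\int[mu2]_p form f1 f2 f3 p| <= X.
Proof.
have [B aB] := a_bounded.
have aB1 p : a p != 0 -> `|p.1| <= B by move=> /aB[].
have id := integrable_dom B.
have iF : mu2.-integrable setT (EFin \o form f1 f2 f3).
  apply: (le_integrable measurableT _ _ id).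
    by apply/measurable_EFinP; apply: mform; [case: sf1|case: sf2|case: sf3].
  move=> p _ /=; rewrite lee_fin; apply: le_trans (ler_norm _).
  exact: form_le_dom.
have mt (f : T1 -> R[i]) n : square_integrable f -> cmeas (trunc f n) by move=> [mf _]; exact: cmeas_trunc.
have cv := @dominated_cvg _ _ _ mu2 setT measurableT (fun n p => (tform n p)%:E)
  (EFin \o form f1 f2 f3) (EFin \o dom_bound B) _ _ _ id _.
have {cv} : (\int[mu2]_p (tform n p)%:E)%E @[n --> \oo] --> (\int[mu2]_p (form f1 f2 f3 p)%:E)%E.
  apply: cv.
  - by move=> n; apply/measurable_EFinP; apply: mform; exact: mt.
  - move=> p _; apply: cvg_near_cst.
    near=> n; rewrite /= /tform /form; congr (complex.Re (_ * _ * _ * _ * _))%:E; near: n; exact: trunc_near.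
  - by move=> p _.
  - move=> n p _ /=; rewrite lee_fin; apply: form_le_dom => // x; exact: cabs_trunc_le.
rewrite -(fineK (integrable_fin_num measurableT iF)) => /fine_cvg cv.
apply/ler_addgt0Pr => e e0.
have /cvgrPdist_le /(_ e e0) ce := cv.
(* One n at which the truncated integral is within e of its limit and obeys the bound X. *)
have [n [hn1 hn2]] := filter_ex (filterI ce tform_le).
rewrite -[\int[mu2]_p _](subrK (\int[mu2]_p tform n p)) addrC.
by apply: le_trans (ler_normD _ _) _; apply: lerD.
Unshelve. all: by end_near. Qed.

End Form.

Theorem theorem2p1 (R : realType) (C0 : R) (hC0 : 1 <= C0) :
  exists C : R,
  forall (d1 d2 mu : R), 0 < d1 -> 0 < d2 -> 0 < mu ->
  forall (I J : set R),
    is_interval I -> is_interval J ->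
    (forall u v, I u -> I v -> `|u - v| <= d1) ->
    (forall u v, J u -> J v -> `|u - v| <= d2) ->
  forall (a : R * R -> R[i]),
    csmooth2 a ->
    supp a `<=` I `*` J ->
    (forall p, cabs (a p) <= C0) ->
    (forall p, cabs (cpdy a p) <= C0 / d2) ->
    (forall p, cabs (cpdy (cpdy a) p) <= C0 / d2 ^+ 2) ->
  forall (S : R * R -> R),
    smooth2 S ->
    let P := pdx (pdy (fun p => pdx S p - pdy S p)) in
    (forall p, Conv (supp a) p ->
       C0^-1 * mu <= `|P p| /\
       `|pdy P p| <= C0 * mu / d2 /\
       `|pdy (pdy P) p| <= C0 * mu / d2 ^+ 2) ->
  forall (lam : R), lam != 0 ->
  forall (f1 f2 f3 : R -> R[i]), L2 f1 -> L2 f2 -> L2 f3 ->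
    cabs (cintegral2 (fun p =>
            expi (lam * S p) * f1 p.1 * f2 p.2 * f3 (p.1 + p.2) * a p))
    <= C * powR `|lam * mu| (- (6^-1)) * (L2norm f1 * L2norm f2 * L2norm f3).
Proof.
(* The modulus is at most the sum of the real and imaginary parts in absolute value, and each of
   them costs [form_cst]. *)
exists (2 * form_cst C0).
move=> d1 d2 m d10 d20 m0 I J _ _ hI hJ a sa suppa a0 a1 a2 S sS P hP lam lam0 f1 f2 f3 sf1 sf2 sf3.
have PE : P = rotational S := rotationalE sS.
have PE1 : pdy P = rotational (pdy S) by rewrite PE; exact: pdy_rotational.
have PE2 : pdy (pdy P) = rotational (pdy (pdy S)).
  by rewrite PE1; exact: pdy_rotational (smooth2_pdy sS).
rewrite PE2 PE1 PE in hP; clear P PE PE1 PE2.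
have hP' p : Conv (supp a) p ->
     [/\ C0^-1 * m <= `|rotational S p|, `|rotational (pdy S) p| <= C0 * m / d2
       & `|rotational (pdy (pdy S)) p| <= C0 * m / d2 ^+ 2].
  by move=> /hP[? [? ?]].
have lm : 0 < `|lam * m| by rewrite normr_gt0 mulf_neq0// gt_eqF.
set r := powR _ _.
have r0 : 0 < r by exact: powR_gt0.
have r6 : r ^+ 6 = `|lam * m|^-1.
  rewrite -powR_mulrn ?ltW// /r -powRrM mulNr mulVf// -powR_inv1// ltW//.
have sq (f : R -> R[i]) : L2 f -> square_integrable f by move=> [? [? ?]]; split.
have bnd := Re_form_le hC0 d20 m0 hI hJ sa suppa a0 a1 a2 sS hP' lam0 r0 r6.
have s1' : square_integrable (fun x => - Complex 0 1 * f1 x).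
  have [[mr mi] foo] := sq _ sf1; split.
    apply: (@cmeasM _ _ (measurableTypeR R) (fun=> - Complex 0 1)) => //.
  apply: le_lt_trans foo; rewrite le_eqVlt; apply/orP; left; apply/eqP.
  apply: eq_integral => x _.
  by rewrite cabsM cabsE/= oppr0 sqrrN expr0n/= expr1n add0r sqrtr1 mul1r.
have bR := bnd _ _ _ (sq _ sf1) (sq _ sf2) (sq _ sf3).
have bI := bnd _ _ _ s1' (sq _ sf2) (sq _ sf3).
apply: le_trans (cabs_le _) _.
rewrite (_ : 2 * form_cst C0 * r * _ = form_cst C0 * r * (L2norm f1 * L2norm f2 * L2norm f3)
  + form_cst C0 * r * (L2norm f1 * L2norm f2 * L2norm f3)); last by ring.
apply: lerD.
  apply: le_trans bR; rewrite le_eqVlt; apply/orP; left; apply/eqP.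
  congr (`|_|); apply: eq_Rintegral => p _; congr complex.Re.
  by rewrite mulrAC.
have -> : L2norm f1 = L2norm (fun x => - Complex 0 1 * f1 x).
  rewrite /L2norm; congr (Num.sqrt (fine _)); apply: eq_integral => x _.
  by rewrite cabsM [cabs (- _)]cabsE/= oppr0 sqrrN expr0n/= expr1n add0r sqrtr1 mul1r.
apply: le_trans bI; rewrite le_eqVlt; apply/orP; left; apply/eqP.
congr (`|_|); apply: eq_Rintegral => p _.
transitivity (complex.Re
  (- Complex 0 1 * (expi (lam * S p) * f1 p.1 * f2 p.2 * f3 (p.1 + p.2) * a p))).
  by rewrite [RHS]cReM /= oppr0 mul0r sub0r mulN1r opprK.
by congr complex.Re; ring.
Qed.
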